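(* Fix $d\ge1$. For all partitions $\mu\subseteq\lambda$ with $\ell(\lambda)\le d$ (set $\lambda_i=0$ for $i>\ell(\lambda)$), as an identity of rational functions in $\beta$, $$\sum_{T\in\operatorname{SIT}(\lambda/\mu)}\ \prod_{k=1}^{m(T)}\left(\left[\prod_{i=1}^d\frac{1+\beta\big(\nu_i(T_{<k})+d-i+1\big)}{1+\beta(\lambda_i+d-i+1)}\right]-1\right)^{-1}\;=\;\sum_{D\in\mathcal D(\lambda/\mu)}(-\beta)^{|D|-|\lambda|}\prod_{(i,j)\in\lambda\setminus D}\frac{\beta(\lambda_i+d-i+1)+1}{h(i,j)}.$$
   Context: Partitions are identified with Young diagrams $\{(i,j):1\le j\le\lambda_i\}$ (English convention, $i$ row, $j$ column); $\lambda'$ is the conjugate, $h(i,j)=\lambda_i-j+\lambda'_j-i+1$ the hook length in $\lambda$, and $|\cdot|$ the number of cells. A standard increasing tableau of skew shape $\lambda/\mu$ is a filling $T$ of the cells of $\lambda/\mu$ by positive integers, strictly increasing along rows and down columns, whose set of entries is exactly $\{1,\dots,m\}$ for some $m=m(T)$; $\operatorname{SIT}(\lambda/\mu)$ is their set. For $k\ge1$, $\nu(T_{<k})$ is the partition whose diagram is $\mu$ together with the cells of $\lambda/\mu$ with entry $<k$; $\nu_i(T_{<k})$ is its $i$-th part. Generalized excited diagrams: for a set $S\subseteq\lambda$ of cells, a cell $(i,j)\in S$ is active if $(i+1,j),(i,j+1),(i+1,j+1)$ all lie in $\lambda\setminus S$. For active $u=(i,j)$, the type I move replaces $(i,j)$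 by $(i+1,j+1)$ in $S$, and the type II move adds $(i+1,j+1)$ to $S$ (keeping $(i,j)$). $\mathcal D(\lambda/\mu)$ is the set of all subsets of $\lambda$ obtainable from the diagram of $\mu$ by finite sequences of moves of types I and II. *)

(* Defs.v *)
From HB Require Import structures.
From mathcomp Require Import all_boot all_order all_algebra.
From mathcomp Require Import fraction.
Set Implicit Arguments. Unset Strict Implicit. Unset Printing Implicit Defensive.
Import Order.TTheory GRing.Theory Num.Theory.

(* Conventions: a partition is a weakly decreasing seq of
   positive naturals; row/column indices are 0-based internally, so the
   paper's cell (i,j) is stored as (i-1,j-1), and the paper's lambda_i is
   nth 0 lam (i-1). *)

Definition is_part (l : seq nat) : bool := sorted geq l && all (fun x => 0 < x) l.

Definition subpart (mu lam : seq nat) : Prop := forall i, nth 0 mu i <= nth 0 lam i.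

Definition in_diag (l : seq nat) (i j : nat) : bool := j < nth 0 l i.

Definition conj_part (l : seq nat) (j : nat) : nat := count (fun x => j < x) l.

Definition hook (l : seq nat) (i j : nat) : nat :=
  nth 0 l i - j.+1 + (conj_part l j - i.+1) + 1.

(* When ell(lam) <= d, all cells of lam (and of any mu \subseteq lam) are in
   the finite type of cells below. *)
Definition cell (d c : nat) := ('I_d * 'I_c)%type.

Section Cells.
Variables (d : nat) (lam mu : seq nat).
Local Notation c := (head 0 lam).
Local Notation cellT := (cell d c).

Definition diag (l : seq nat) : {set cellT} := [set x : cellT | in_diag l x.1 x.2].

Definition skewc : {set cellT} := diag lam :\: diag mu.

Definition memc (S : {set cellT}) (i j : nat) : bool :=
  [exists x in S, (x.1 == i :> nat) && (x.2 == j :> nat)].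

Definition freec (S : {set cellT}) (i j : nat) : bool := in_diag lam i j && ~~ memc S i j.

Definition active (S : {set cellT}) (u : cellT) : bool :=
  [&& u \in S, freec S u.1.+1 u.2, freec S u.1 u.2.+1 & freec S u.1.+1 u.2.+1].

Definition emove : rel {set cellT} := fun S S' =>
  [exists u, exists v : cellT,
     [&& active S u, (v.1 == u.1.+1 :> nat), (v.2 == u.2.+1 :> nat) &
         (S' == (S :\ u) :|: [set v]) || (S' == v |: S)]].

Definition excited : {set {set cellT}} := [set S | connect emove (diag mu) S].

(* Increasing tableaux: fillings of the cells of lam/mu, encoded as finite
   functions equal to 0 outside lam/mu.  Entries of an SIT are at most
   #cells of lam/mu <= sumn lam, so the bound 'I_(sumn lam).+1 loses nothing. *)
Definition tabT := {ffun cellT -> 'I_(sumn lam).+1}.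

Definition mT (T : tabT) : nat := \max_(x : cellT) (T x : nat).

Definition is_SIT (T : tabT) : bool :=
  [&& [forall x, (x \in skewc) == (0 < T x)],
      [forall x in skewc, forall y in skewc,
         ((x.1 == y.1) && (x.2 < y.2)) ==> (T x < T y)],
      [forall x in skewc, forall y in skewc,
         ((x.2 == y.2) && (x.1 < y.1)) ==> (T x < T y)] &
      [forall k : 'I_(sumn lam).+1, (0 < k <= mT T) ==>
         [exists x in skewc, T x == k]]].

Definition SIT : {set tabT} := [set T | is_SIT T].

Definition nu (T : tabT) (k i : nat) : nat :=
  nth 0 mu i + #|[set x in skewc | (x.1 == i :> nat) && (T x < k)]|.

End Cells.

Definition RF := {fraction {poly rat}}.
Definition beta : RF := @FracField.tofrac _ ('X : {poly rat}).

(* Main.v *)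
(* Put X_i = 1 + beta (lambda_i + d - i + 1) and Y_j = 1 + beta (d - lambda'_j + j).
   Since X_i - Y_j = beta h(i,j), the right-hand side is, up to a factor depending
   on lambda only, F(mu) = sum over D of prod over (i,j) in D of (Y_j / X_i - 1).
   The numbers X_i and Y_j label the vertical and horizontal steps of the boundary
   path of lambda; let wt(mu) be the product of the labels at the positions of the
   vertical steps of mu.  The left-hand side is determined by peeling off the cells
   with entry 1, so it suffices to prove the Chevalley formula
     wt(mu) / wt(lambda) F(mu) = sum of F(nu), over nu = mu + a set of addable corners.
   Adding a corner (r,s) to lambda keeps all X_i and Y_j and changes F to
     F(mu) + (Y_s / X_r - 1) (F(mu) + F(mu minus its corner on that diagonal)),
   the second term being present only when mu has such a corner, so the formula
   follows by induction on lambda.  This recursion holds because the excited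
   diagrams are the subsets of lambda whose cells, read in any linear extension as a
   word in the 0-Hecke monoid acting by addition of corners, build mu. *)
Require Import Defs.
From HB Require Import structures.
From mathcomp Require Import all_boot all_order all_algebra.
From mathcomp Require Import fraction.
From mathcomp Require Import ring zify.
From Stdlib Require Import FunctionalExtensionality.
Set Implicit Arguments. Unset Strict Implicit. Unset Printing Implicit Defensive.
Import Order.TTheory GRing.Theory Num.Theory.

(** * Edge words and the 0-Hecke monoid *)

(* A partition is seen through its boundary path, read from the lower left: [M p]
   tells whether step [p] is vertical.  Adding a box turns [M k, M k.+1] = (true, false)
   into (false, true); [hv k M] says that a box can be removed there, giving [dn k M]. *)
Section Words.
Variables (d n : nat).
Implicit Types (M : nat -> bool) (A : {set 'I_n}) (k l p : nat) (w : seq nat).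

Definition hv k M := ~~ M k && M k.+1.

Definition dn k M p := (p == k) || (p != k.+1) && M p.

Definition ground p := p < d.

Definition agree M M' := [forall p : 'I_n.+1, M p == M' p].

Definition addable M : {set 'I_n} := [set k : 'I_n | M k && ~~ M k.+1].

Definition nmem A p := p \in image (@nat_of_ord n) (mem A).

Definition raise A M p := M p && ~~ nmem A p || (0 < p) && nmem A p.-1.

Lemma agreeP M M' : reflect (forall p, p <= n -> M p = M' p) (agree M M').
Proof.
apply: (iffP forallP) => [h p pn|h p].
  by have /eqP := h (Ordinal (pn : p < n.+1)).
by apply/eqP/h; rewrite -ltnS.
Qed.

Lemma nmemE A (k : 'I_n) : nmem A k = (k \in A).
Proof. exact/mem_image/val_inj. Qed.

Lemma nmem_ord A p (pn : p < n) : nmem A p = (Ordinal pn \in A).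
Proof. exact: nmemE A (Ordinal pn). Qed.

Lemma nmem_lt A p : nmem A p -> p < n.
Proof. by case/imageP=> k _ ->; exact: ltn_ord. Qed.

Lemma nmem_addable A M p : A \subset addable M -> nmem A p -> M p && ~~ M p.+1.
Proof.
move=> /subsetP sA Ap; have pn := nmem_lt Ap; move: Ap.
by rewrite (nmem_ord _ pn) => /sA; rewrite inE.
Qed.

Lemma nmemU1 A (k : 'I_n) p : nmem (k |: A) p = (p == k) || nmem A p.
Proof.
case: (ltnP p n) => pn; first by rewrite !(nmem_ord _ pn) !inE -val_eqE.
have -> : (p == k) = false by apply/negP => /eqP pk; move: (ltn_ord k); lia.
by apply/idP/idP => /= /nmem_lt; lia.
Qed.

Lemma raise0 M : raise set0 M = M.
Proof.
have n0 p : nmem set0 p = false by apply/imageP => -[k]; rewrite inE.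
by apply: functional_extensionality => p; rewrite /raise !n0 andbT andbF orbF.
Qed.

Lemma hv_dn k M : hv k (dn k M) = false.
Proof. by rewrite /hv /dn eqxx. Qed.

Lemma hv_dn_far k l M : (k.+1 < l) || (l.+1 < k) -> hv l (dn k M) = hv l M.
Proof.
move=> kl; rewrite /hv /dn.
have -> : (l == k) = false by lia.
have -> : (l == k.+1) = false by lia.
have -> : (l.+1 == k) = false by lia.
by have -> : (l.+1 == k.+1) = false by lia.
Qed.

Lemma dn_comm k l M : (k.+1 < l) || (l.+1 < k) -> dn l (dn k M) = dn k (dn l M).
Proof.
move=> kl; apply: functional_extensionality => p; rewrite /dn.
case: (p =P l) => [->|_].
  by have [-> ->] : (l == k) = false /\ (l == k.+1) = false by lia.
case: (p =P l.+1) => [->|_]; rewrite //= ?andbF.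
by have -> : (l.+1 == k) = false by lia.
Qed.

(* [hk w M]: applying the letters of [w] from right to left to the empty
   partition, in the 0-Hecke monoid, yields the partition with edge word [M]. *)
Fixpoint hk w M : bool :=
  if w is k :: w' then hv k M && (hk w' M || hk w' (dn k M)) else agree M ground.

(** No box is removable from [dn k M] at [k], so the shorter word never builds [dn k M] and the
    letter applied last must act trivially. *)
Lemma hk_idem k w : hk (k :: k :: w) =1 hk (k :: w).
Proof.
by move=> M /=; rewrite hv_dn; case: (hv k M) => //=; rewrite orbF.
Qed.

Lemma hk_comm k l w : (k.+1 < l) || (l.+1 < k) -> hk (k :: l :: w) =1 hk (l :: k :: w).
Proof.
move=> kl M /=; rewrite hv_dn_far // hv_dn_far; last by rewrite orbC.
rewrite (dn_comm _ kl).
by case: (hv k M); case: (hv l M) => //=; rewrite orbACA.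
Qed.

Lemma hk_cat w w1 w2 : hk w1 =1 hk w2 -> hk (w ++ w1) =1 hk (w ++ w2).
Proof. by move=> e; elim: w => //= k w IH M; rewrite !IH. Qed.

Lemma hk_move k b w : all (fun l => (k.+1 < l) || (l.+1 < k)) b ->
  hk (b ++ k :: w) =1 hk (k :: b ++ w).
Proof.
elim: b => [|l b IH] // /andP[kl /IH{}IH] M.
rewrite -[LHS]/(hk ([:: l] ++ (b ++ k :: w)) M) (hk_cat _ IH).
by apply: hk_comm; rewrite orbC.
Qed.

(** The letters act as partial functions. In the mixed cases one word would build both [M], with no
    vertical step at [k], and [dn k M'], with one there, or the reverse. *)
Lemma hk_uniq w M M' : all (fun k => k < n) w -> hk w M -> hk w M' -> agree M M'.
Proof.
elim: w M M' => /= [|k w IH] M M'.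
  move=> _ /agreeP h /agreeP h'; apply/agreeP => p pn.
  by rewrite h // h'.
case/andP=> kn wn /andP[/andP[Mk Mk1] h] /andP[/andP[Mk' Mk1'] h'].
have kk1 : (k.+1 == k) = false by lia.
case/orP: h => h; case/orP: h' => h'; have /agreeP := IH _ _ wn h h' => e; apply/agreeP => //.
- by have := e k (ltnW kn); rewrite /dn eqxx /= (negbTE Mk).
- by have := e k (ltnW kn); rewrite /dn eqxx /= (negbTE Mk').
move=> p pn; have := e p pn; rewrite /dn.
case: (p =P k) => [->|_]; first by rewrite (negbTE Mk) (negbTE Mk').
by case: (p =P k.+1) => [->|_] //; rewrite Mk1 Mk1'.
Qed.

(** * Adding a set of corners, seen at one fixed position *)

Section Raise.
Variables (k : 'I_n).

Lemma hv_raise_flat M A : A \subset addable M -> M k = M k.+1 -> hv k (raise A M) = false.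
Proof.
move=> sA Mk; have Ak : nmem A k = false.
  by apply/negP => Ak; have := nmem_addable sA Ak; rewrite Mk andbN.
by rewrite /hv /raise Ak /= -Mk andbT orbF; case: (M k); rewrite ?andbF.
Qed.

Lemma hv_raise_addable M A : A \subset addable M -> k \in addable M ->
  hv k (raise A M) = (k \in A).
Proof.
rewrite inE => sA /andP[Mk /negbTE Mk1].
rewrite /hv /raise Mk Mk1 -nmemE /=; case: (boolP (nmem A k)) => //= _.
by rewrite ?andbT ?orbF; apply/negP => /andP[k0 Ak]; have := nmem_addable sA Ak;
  rewrite prednK // Mk andbF.
Qed.

Lemma dn_raiseU1 M A : A \subset addable M -> k \in addable M -> k \notin A ->
  dn k (raise (k |: A) M) = raise A M.
Proof.
rewrite inE -nmemE => sA /andP[Mk /negbTE Mk1] /negbTE Ak.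
apply: functional_extensionality => p; rewrite /dn /raise !nmemU1.
case: (p =P k) => [->|pk] /=; first by rewrite Mk Ak.
case: (p =P k.+1) => [->|pk1] /=; first by rewrite Mk1 Ak.
by case: p pk pk1 => //= p pk pk1; have -> : (p == k) = false by lia.
Qed.

Lemma addable_dn M : hv k M -> k \in addable (dn k M).
Proof. by rewrite inE /dn !eqxx /= orbF => _; lia. Qed.

(** Once the box at [k] is gone, [k] is addable and the positions next to it are not; these
    neighbours are exactly the corners whose addition to [M] would cover that box. *)
Lemma hv_raise_hv M A : hv k M ->
  (A \subset addable M) && hv k (raise A M) = (A \subset addable (dn k M)) && (k \notin A).
Proof.
move=> /andP[/negbTE Mk Mk1]; apply/andP/andP => -[/subsetP sA].
  move=> hvA; have kA : k \notin A by apply/negP => /sA; rewrite inE Mk.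
  split=> //; apply/subsetP => l lA.
  have lk : (l == k :> nat) = false.
    by apply/negP => /eqP/val_inj lk; move: kA; rewrite -lk lA.
  move: (sA l lA); rewrite !inE /dn lk eqSS lk /=.
  move: hvA; rewrite /hv /raise Mk Mk1 /= (nmemE A k) (negbTE kA) orbF => /andP[n1 n2].
  move=> /andP[-> /negbTE->]; rewrite ?andbT ?andbF ?orbF; apply/andP; split.
    by apply: contra n2 => /eqP <-; rewrite nmemE.
  by apply: contra n1 => /eqP lk1; rewrite -lk1 /= nmemE.
move=> kA; have sA' : A \subset addable M.
  apply/subsetP => l lA.
  have lk : (l == k :> nat) = false.
    by apply/negP => /eqP/val_inj lk; move: kA; rewrite -lk lA.
  move: (sA l lA); rewrite !inE /dn lk eqSS lk /= => /andP[/andP[_ ->]].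
  by rewrite negb_or => /andP[].
split=> //; rewrite /hv /raise Mk Mk1 /= (nmemE A k) (negbTE kA) orbF.
apply/andP; split.
  apply/negP => /andP[k0]; have kn : k.-1 < n by apply: leq_ltn_trans (ltn_ord k); lia.
  by rewrite (nmem_ord _ kn) => /sA; rewrite inE /dn /= prednK // eqxx andbF.
by apply/negP => /[dup] /nmem_lt kn; rewrite (nmem_ord _ kn) => /sA; rewrite inE /dn /= eqxx; lia.
Qed.

Lemma raise_dn M A : hv k M -> A \subset addable (dn k M) -> k \notin A ->
  raise (k |: A) (dn k M) = raise A M.
Proof.
move=> /andP[/negbTE Mk Mk1] sA; rewrite -nmemE => kA.
have k1A : nmem A k.+1 = false.
  by apply/negP => Ak; have := nmem_addable sA Ak; rewrite /dn eqxx; lia.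
have k0A : 0 < k -> nmem A k.-1 = false.
  by move=> k0; apply/negP => Ak; have := nmem_addable sA Ak; rewrite prednK // /dn eqxx andbF.
apply: functional_extensionality => p; rewrite /dn /raise !nmemU1.
case: (p =P k) => [->|pk] /=.
  by rewrite Mk /=; case: (ltnP 0 k) => //= k0; rewrite k0A // orbF; lia.
case: (p =P k.+1) => [->|pk1] /=; first by rewrite Mk1 k1A eqxx.
by case: p pk pk1 => //= p pk pk1; have -> : (p == k) = false by lia.
Qed.

End Raise.
End Words.

(** * The Chevalley formula *)

Section SplitSum.
Local Open Scope ring_scope.

(** Each subset avoiding [k] is paired with its union with [k]. *)
Lemma sum_subsets_split (V : nmodType) (T : finType) (S : {set T}) (k : T) (g : {set T} -> V) :
  k \in S ->
  \sum_(A : {set T} | A \subset S) g A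
  = \sum_(A : {set T} | (A \subset S) && (k \notin A)) (g A + g (k |: A)).
Proof.
move=> kS; rewrite big_split (bigID (fun A : {set T} => k \notin A)) /=; congr (_ + _).
rewrite (reindex_onto (fun A => k |: A) (fun A => A :\ k)) /=; last first.
  by move=> A /andP[_]; rewrite negbK => /setD1K.
apply: eq_bigl => A; rewrite negbK setU11 andbT subUset sub1set kS /=; congr (_ && _).
apply/eqP/idP => [<-|kA]; first by rewrite !inE eqxx.
by apply/setP => x; rewrite !inE; case: eqP => //= ->; rewrite (negbTE kA).
Qed.

End SplitSum.

Section Chevalley.
Local Open Scope ring_scope.
Variables (K : fieldType) (d n : nat) (C : Type) (kk : C -> nat) (tt : C -> K) (W : K).
Implicit Types (M : nat -> bool) (Z : nat -> K) (L : seq C).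

Definition wt Z M : K := \prod_(p < n.+1) (if M p then Z p else 1).

Definition swapf k Z p := if p == k then Z k.+1 else if p == k.+1 then Z k else Z p.

(* The head of the list is the last cell added. *)
Fixpoint loc L M : K :=
  if L is x :: L' then
    loc L' M + (if hv (kk x) M then tt x * (loc L' M + loc L' (dn (kk x) M)) else 0)
  else (agree n M (ground d))%:R.

(* [Z] labels the steps after all of [L] has been added; undoing the last cell
   exchanges the two labels at its position. *)
Fixpoint good Z L : Prop :=
  if L is x :: L' then
    [/\ (kk x < n)%N, Z (kk x).+1 != 0, tt x = Z (kk x) / Z (kk x).+1 - 1
      & good (swapf (kk x) Z) L']
  else wt Z (ground d) = W.

Definition raises (f : (nat -> bool) -> K) M : K :=
  \sum_(A : {set 'I_n} | A \subset addable n M) f (raise A M).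

(** Isolates the two factors affected by a box at [k]; the remaining product is unchanged by
    [swapf k] and by [dn k]. *)
Lemma wt_split (k : 'I_n) Z M : wt Z M =
  (if M k then Z k else 1) * ((if M k.+1 then Z k.+1 else 1) *
  \prod_(p < n.+1 | (p != k :> nat) && (p != k.+1 :> nat)) (if M p then Z p else 1)).
Proof.
have kn : (k < n.+1)%N by apply: ltnW; rewrite ltnS.
have k1n : (k.+1 < n.+1)%N by rewrite ltnS.
rewrite /wt (bigD1 (Ordinal kn)) //= (bigD1 (Ordinal k1n)) /=; last first.
  by rewrite -val_eqE /=; lia.
by congr (_ * (_ * _)); apply: eq_bigl => p; rewrite -!val_eqE.
Qed.

Lemma wt_rest (k : 'I_n) Z M :
  \prod_(p < n.+1 | (p != k :> nat) && (p != k.+1 :> nat)) (if M p then swapf k Z p else 1)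
  = \prod_(p < n.+1 | (p != k :> nat) && (p != k.+1 :> nat)) (if M p then Z p else 1).
Proof.
by apply: eq_bigr => p /andP[/negbTE pk /negbTE pk1]; rewrite /swapf pk pk1.
Qed.

Lemma wt_rest_dn (k : 'I_n) Z M :
  \prod_(p < n.+1 | (p != k :> nat) && (p != k.+1 :> nat)) (if dn k M p then Z p else 1)
  = \prod_(p < n.+1 | (p != k :> nat) && (p != k.+1 :> nat)) (if M p then Z p else 1).
Proof.
by apply: eq_bigr => p /andP[/negbTE pk pk1]; rewrite /dn pk pk1.
Qed.

(** Induction on the cells, with the labels generalized because undoing the last cell exchanges two
    of them. The cases are a removable box at [k], an addable one, or two equal steps. *)
Lemma chevalley Z L M : good Z L -> wt Z M * loc L M = W * raises (loc L) M.
Proof.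
elim: L Z M => [|x L IH] Z M /=.
  move=> wW; rewrite /raises (bigD1 set0) ?sub0set //= raise0 big1 ?addr0.
    by case: agreeP => [e|_]; rewrite ?mulr0 // -wW; congr (_ * _); apply: eq_bigr => p _;
      rewrite e // -ltnS.
  (* A nonempty [A] leaves a removable box, and [ground d] has none. *)
  move=> A /andP[sA /set0Pn[k kA]]; case: agreeP => // e; exfalso.
  have := hv_raise_addable sA (subsetP sA k kA); rewrite kA /hv.
  have kn := ltn_ord k; rewrite !e /ground; lia.
case=> kn; have [k kE] : {k : 'I_n | kk x = k} by exists (Ordinal kn).
rewrite kE => Zk1 tE gd; have {}IH M' := IH _ M' gd.
have swk : swapf k Z k = Z k.+1 by rewrite /swapf eqxx.
have swk1 : swapf k Z k.+1 = Z k by rewrite /swapf eqxx; case: eqP => //; lia.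
case: (boolP (hv k M)) => [hvM|nhv].
  have kM' := @addable_dn n k M hvM.
  (* By [hv_raise_hv] the extra terms run over the sets [A] avoiding [k] and addable to [dn k M];
     the two summands are those of [k |: A] and [A] in the sum at [dn k M]. *)
  have -> : raises (fun M0 => loc L M0 + (if hv k M0 then tt x * (loc L M0 + loc L (dn k M0)) else 0)) M
     = raises (loc L) M + tt x * raises (loc L) (dn k M).
    rewrite /raises big_split /=; congr (_ + _).
    rewrite -big_mkcondr /= (eq_bigl _ _ (fun A => @hv_raise_hv n k M A hvM)) /=.
    rewrite (sum_subsets_split _ kM') mulr_sumr; apply: eq_bigr => A /andP[sA kA].
    by rewrite -(@raise_dn n k M A hvM sA kA) (@dn_raiseU1 n k (dn k M) A sA kM' kA) addrC.
  rewrite [RHS]mulrDr [X in _ = _ + X]mulrCA -!IH.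
  move: (hvM) => /andP[/negbTE Mk Mk1].
  have dk : dn k M k by rewrite /dn eqxx.
  have dk1 : dn k M k.+1 = false by rewrite /dn eqxx; lia.
  (* The value of [tt x] gives [Z k.+1 * (1 + tt x) = Z k], which compensates the exchange of
     labels. *)
  rewrite !(wt_split k) !wt_rest !wt_rest_dn /= swk swk1 Mk Mk1 dk dk1 tE; field.
  by [].
rewrite addr0.
case: (boolP (M k && ~~ M k.+1)) => [vh|nvh].
  have kM : k \in addable n M by rewrite inE.
  (* Here undoing the box at [k] sends the term of [k |: A] back to that of [A], and the term of [A]
     has no removable box at [k]. *)
  have -> : raises (fun M0 => loc L M0 + (if hv k M0 then tt x * (loc L M0 + loc L (dn k M0)) else 0)) M
     = (1 + tt x) * raises (loc L) M.
    rewrite /raises !(sum_subsets_split _ kM) mulr_sumr; apply: eq_bigr => A /andP[sA kA].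
    have sA' : k |: A \subset addable n M by rewrite subUset sub1set kM.
    rewrite !hv_raise_addable // setU11 (negbTE kA) (@dn_raiseU1 n k M A sA kM kA).
    ring.
  rewrite mulrCA -IH.
  move: vh => /andP[Mk /negbTE Mk1].
  rewrite !(wt_split k) !wt_rest /= swk Mk Mk1 tE; field.
  by [].
(* Two equal steps: no [A] creates a removable box at [k], and [wt] is symmetric in the two
   labels. *)
have MM : M k = M k.+1 by move: nhv nvh; rewrite /hv; case: (M k); case: (M k.+1).
have -> : raises (fun M0 => loc L M0 + (if hv k M0 then tt x * (loc L M0 + loc L (dn k M0)) else 0)) M
     = raises (loc L) M.
  by apply: eq_bigr => A sA; rewrite (@hv_raise_flat n k M A sA MM) addr0.
rewrite -IH !(wt_split k) !wt_rest /= swk swk1 MM.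
by case: (M k.+1); ring.
Qed.

End Chevalley.

(** * The recursion as a sum over subwords *)

Section Expansion.
Local Open Scope ring_scope.
Variables (K : fieldType) (d n : nat) (C : finType) (kk : C -> nat) (tt : C -> K).
Implicit Types (M : nat -> bool) (L : seq C) (S A : {set C}).

Definition word S L := [seq kk x | x <- L & x \in S].

Lemma word_cat S L1 L2 : word S (L1 ++ L2) = word S L1 ++ word S L2.
Proof. by rewrite /word filter_cat map_cat. Qed.

Lemma eq_word S S' L : {in L, S =i S'} -> word S L = word S' L.
Proof. by move=> e; rewrite /word; congr map; apply: eq_in_filter => x /e. Qed.

(** Unrolling the recursion chooses the cells that are used. For a chosen cell, the terms at [M] and
    at [dn (kk x) M] are the two ways its letter can act in [hk]; by [hk_uniq] they exclude each
    other, so no set is counted twice. *)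
Lemma loc_expand L M : uniq L -> all (fun x => kk x < n)%N L ->
  loc d n kk tt L M =
  \sum_(S : {set C} | S \subset L) if hk d n (word S L) M then \prod_(x in S) tt x else 0.
Proof.
elim: L M => [|x L IH] M.
  move=> _ _ /=; rewrite (big_pred1 set0) ?big_set0; first by case: agree.
  move=> S; apply/subsetP/eqP => [h|-> y]; last by rewrite inE.
  by apply/setP => y; rewrite inE; apply/negP => /h.
move=> /= /andP[xL uL] /andP[kn aL].
have -> : \sum_(S : {set C} | S \subset x :: L)
    (if hk d n (word S (x :: L)) M then \prod_(y in S) tt y else 0) =
  \sum_(S : {set C} | S \subset (x |: [set y in L]))
    (if hk d n (word S (x :: L)) M then \prod_(y in S) tt y else 0).
  by apply: eq_bigl => S; apply: eq_subset_r => y; rewrite !inE.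
rewrite (@sum_subsets_split _ _ _ x) ?setU11 //.
rewrite [in LHS]IH // [RHS](eq_bigl (fun A => A \subset L)); last first.
  move=> A; apply/andP/idP => [[/subsetP sA xA]|/subsetP sA].
    apply/subsetP => y yA; move: (sA y yA); rewrite !inE => /orP[/eqP yx|//].
    by move: xA; rewrite -yx yA.
  split; last by apply: contra xL => /sA.
  by apply/subsetP => y /sA yL; rewrite !inE; apply/orP; right.
rewrite big_split /=; congr (_ + _).
  apply: eq_bigr => A sA; have xA : x \notin A by apply: contra xL => /(subsetP sA).
  by rewrite /word /= (negbTE xA).
case: (boolP (hv (kk x) M)) => [h|nh]; last first.
  by rewrite big1 // => A sA; rewrite /word /= setU11 /= (negbTE nh).
rewrite !IH // -big_split mulr_sumr; apply: eq_bigr => A sA.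
have xA : x \notin A by apply: contra xL => /(subsetP sA).
have -> : word (x |: A) (x :: L) = kk x :: word A L.
  rewrite /word /= setU11 /=; congr (_ :: _).
  by apply: eq_word => y yL; rewrite !inE; case: eqP => // yx; move: xL; rewrite -yx yL.
rewrite big_setU1 //= h /=.
have wn : all (fun k => k < n)%N (word A L).
  by rewrite all_map all_filter; apply: sub_all aL => y /= ->; rewrite implybT.
case h1: (hk _ _ _ M); case h2: (hk _ _ _ (dn _ _)); rewrite ?addr0 ?add0r ?mulr0 //=.
exfalso; have /agreeP e := hk_uniq wn h1 h2.
by have := e _ (ltnW kn); rewrite /dn eqxx /=; move: h => /andP[/negbTE->].
Qed.

End Expansion.

(** * Edge words of row-length functions *)

(* Edge word of the partition with [d] rows of lengths [r 0, r 1, ...]: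
   its [i]-th row carries the vertical step with label [r i + d - 1 - i]. *)
Section EdgeWords.
Variable d : nat.
Implicit Types (r : nat -> nat) (R : pred nat).

Definition edge r p := [exists i : 'I_d, p == r i + d - i.+1].

Definition decr r := forall i j, i <= j -> r j <= r i.

Definition corner r i := i < d /\ forall i', i' < i -> r i < r i'.

Lemma edgeP r p : reflect (exists2 i, i < d & p = r i + d - i.+1) (edge r p).
Proof.
apply: (iffP existsP) => [[i /eqP->]|[i id ->]]; first by exists i.
by exists (Ordinal id) => /=.
Qed.

Lemma edge_ground : edge (fun=> 0) = ground d.
Proof.
apply: functional_extensionality => p; apply/edgeP/idP => [[i id ->]|].
  by rewrite /ground; lia.
by rewrite /ground => pd; exists (d - p.+1); lia.
Qed.

Lemma eq_edge r r' : (forall i, i < d -> r i = r' i) -> edge r = edge r'.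
Proof.
move=> e; apply: functional_extensionality => p.
by apply/edgeP/edgeP => -[i id ->]; exists i => //; rewrite e.
Qed.

(** The box ends the row whose vertical step is [k.+1]; were the next row equally long, its vertical
    step would be [k]. *)
Lemma edge_hv r k : decr r -> (forall i, d <= i -> r i = 0) -> hv k (edge r) ->
  exists p, [/\ p < d, k.+1 = r p + d - p.+1, 0 < r p & r p.+1 < r p].
Proof.
move=> dr r0 /andP[/edgeP nk /edgeP[p pd kE]]; exists p.
have rp : 0 < r p.
  rewrite lt0n; apply/eqP => rp0; apply: nk; exists p.+1; first lia.
  by have := dr p p.+1 (leqnSn p); lia.
split=> //; have := dr p p.+1 (leqnSn p); rewrite leq_eqVlt => /orP[/eqP e|//].
case: (ltnP p.+1 d) => pd1; last by rewrite r0.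
by case: nk; exists p.+1 => //; lia.
Qed.

Lemma edge_vh r k : decr r -> edge r k -> ~~ edge r k.+1 ->
  exists2 p, k = r p + d - p.+1 & corner r p.
Proof.
move=> dr /edgeP[p pd kE] /edgeP nk; exists p => //; split=> // -[|i] ip; first by
  rewrite ltnNge; apply/negP => rp; apply: nk; case: p pd kE ip rp => // p pd kE _ rp;
  exists p; [lia | have := dr 0 p.+1; have := dr 0 p; have := dr p p.+1; lia].
rewrite ltnNge; apply/negP => rp; apply: nk; exists p.-1; first lia.
have := dr i.+1 p.-1; have := dr p.-1 p; lia.
Qed.

(** Vertical steps have strictly decreasing positions from row to row. So the step of row [i] cannot
    belong to an earlier row of [r'], where both functions agree, nor, if [r' i < r i], to row [i]
    or a later one. *)
Lemma edge_inj_le n r r' : decr r -> decr r' ->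
  (forall i, i < d -> r i + d - i.+1 <= n) ->
  agree n (edge r) (edge r') -> forall i, i < d -> (forall j, j < i -> r j = r' j) -> r i <= r' i.
Proof.
move=> dr dr' rn /agreeP e i id IH; rewrite leqNgt; apply/negP => lt.
have : edge r' (r i + d - i.+1) by rewrite -e ?rn //; apply/edgeP; exists i.
case/edgeP => j jd; have [ji|ij] := ltnP j i.
  by have := IH j ji; have := dr j i; lia.
by have := dr' i j ij; lia.
Qed.

Lemma edge_inj n r r' : decr r -> decr r' ->
  (forall i, i < d -> r i + d - i.+1 <= n) -> (forall i, i < d -> r' i + d - i.+1 <= n) ->
  agree n (edge r) (edge r') -> forall i, i < d -> r i = r' i.
Proof.
move=> dr dr' rn rn' e i; elim/ltn_ind: i => i IH id.
have IH' j : j < i -> r j = r' j by move=> ji; apply: IH => //; lia.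
have e' : agree n (edge r') (edge r).
  by apply/agreeP => p pn; move/agreeP: e => ->.
apply/eqP; rewrite eqn_leq (edge_inj_le dr dr' rn e id IH').
by apply: (edge_inj_le dr' dr rn' e' id) => j /IH'.
Qed.

(** Distinct rows have distinct vertical steps, and lengthening a row by one cell moves its step to
    the next position. *)
Lemma edge_add r R p : decr r -> (forall i, R i -> corner r i) ->
  edge (fun i => r i + R i) p =
  edge r p && ~~ [exists i : 'I_d, R i && (p == r i + d - i.+1)]
  || [exists i : 'I_d, R i && (p == (r i + d - i.+1).+1)].
Proof.
move=> dr cR; apply/edgeP/orP.
  move=> [i id pE]; case Ri: (R i) pE => pE.
    by right; apply/existsP; exists (Ordinal id); rewrite /= Ri; lia.
  left; apply/andP; split; first by apply/edgeP; exists i; lia.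
  apply/existsP => -[j /andP[Rj /eqP pj]].
  have [ij|ji|ij] := ltngtP i j.
  - by have := dr _ _ (ltnW ij); have := ltn_ord j; lia.
  - by have := dr _ _ (ltnW ji); lia.
  - by rewrite -ij Ri in Rj.
move=> [/andP[/edgeP[i id pE] nR]|/existsP[i /andP[Ri /eqP pE]]].
  exists i => //; case Ri: (R i); last lia.
  by case/existsP: nR; exists (Ordinal id); rewrite /= Ri pE /=.
by exists i => //; rewrite Ri; have := ltn_ord i; lia.
Qed.

Lemma edge_add1 r p : decr r -> corner r p ->
  hv (r p + d - p.+1) (edge (fun i => r i + (i == p))) /\
  dn (r p + d - p.+1) (edge (fun i => r i + (i == p))) = edge r.
Proof.
move=> dr cp; set k := r p + d - p.+1; have pd := cp.1.
have cR i : pred1 p i -> corner r i by move=> /eqP->.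
have ex (f : nat -> nat) (q : nat) : [exists i : 'I_d, pred1 p (val i) && (q == f (val i))] = (q == f p).
  apply/existsP/idP => [[i /andP[/eqP-> //]]|qf].
  by exists (Ordinal pd); rewrite /= eqxx.
have E q : edge (fun i => r i + (i == p)) q = edge r q && (q != k) || (q == k.+1).
  have := edge_add q dr cR.
  by rewrite (ex (fun i => r i + d - i.+1)) (ex (fun i => (r i + d - i.+1).+1)).
have ek : edge r k by apply/edgeP; exists p.
have ek1 : edge r k.+1 = false.
  apply/edgeP => -[i id]; rewrite /k; have [ip|pi|->] := ltngtP i p.
  - by have := cp.2 _ ip; lia.
  - by have := dr _ _ (ltnW pi); lia.
  - lia.
split; first by rewrite /hv !E ek ek1 !eqxx /=; lia.
apply: functional_extensionality => q; rewrite /dn E.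
case: (q =P k) => [->|_]; first by rewrite ek.
case: (q =P k.+1) => [->|_]; first by rewrite ek1.
by rewrite andbT orbF.
Qed.

End EdgeWords.

Lemma connect_homo (T U : finType) (e : rel T) (e' : rel U) (f : T -> U) :
  {homo f : x y / e x y >-> connect e' x y} -> {homo f : x y / connect e x y >-> connect e' x y}.
Proof.
move=> h x y /connectP[p]; elim: p x => [|z p IH] x /=; first by move=> _ ->.
by move=> /andP[/h xz zp] yE; apply: connect_trans xz (IH _ zp yE).
Qed.

(** * Excited diagrams *)

Section Cells.
Variables (d : nat) (lam : seq nat).
Local Notation c := (head 0 lam).
Local Notation cellT := (cell d c).
Implicit Types (r : nat -> nat) (S : {set cellT}) (L : seq cellT) (x y u v : cellT).

(** The content shifted by [d - 1]: constant on diagonals, and the position of the first of the two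
    steps exchanged by adding the cell. *)
Definition letter x := x.2 + d - x.1.+1.

Definition shape r : {set cellT} := [set x : cellT | x.2 < r x.1].

(* [lin L r]: reversed, [L] builds the diagram with row lengths [r] cell by cell. *)
Inductive lin : seq cellT -> (nat -> nat) -> Prop :=
| lin_nil r : (forall i, r i = 0) -> lin [::] r
| lin_cons x L r r' : lin L r -> corner d r x.1 -> r x.1 = x.2 ->
    (forall i, r' i = r i + (i == x.1)) -> lin (x :: L) r'.

Lemma letter_lt x : letter x < d + c.
Proof. by rewrite /letter; have := ltn_ord x.1; have := ltn_ord x.2; lia. Qed.

Lemma cell_inj x y : x.1 = y.1 :> nat -> x.2 = y.2 :> nat -> x = y.
Proof. by case: x y => [a b] [a' b'] /= /val_inj-> /val_inj->. Qed.

Lemma lin_decr L r : lin L r -> decr r.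
Proof.
elim=> {L r} [r r0|x L r r' _ dr [xd cx] rx r'E] i j ij; first by rewrite !r0.
rewrite !r'E; have := dr _ _ ij; case: (j =P x.1) => [jE|]; last lia.
move: ij; rewrite leq_eqVlt => /orP[/eqP->|ij]; first by rewrite jE eqxx; lia.
by have := cx i; rewrite -jE => /(_ ij); lia.
Qed.

Lemma lin_out L r i : lin L r -> d <= i -> r i = 0.
Proof.
elim=> {L r} [r r0|x L r r' _ IH _ _ r'E] di; first by rewrite r0.
by rewrite r'E IH //; have := ltn_ord x.1; lia.
Qed.

Lemma lin_le L r i : lin L r -> r i <= c.
Proof.
elim=> {L r} [r r0|x L r r' _ IH _ rx r'E]; first by rewrite r0.
by rewrite r'E; case: eqP => [->|_]; rewrite ?rx ?addn0 // addn1; exact: ltn_ord.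
Qed.

Lemma lin_mem L r x : lin L r -> (x \in L) = (x.2 < r x.1).
Proof.
elim=> {L r} [r r0|y L r r' _ IH _ ry r'E]; first by rewrite r0.
rewrite inE IH r'E; case: (x.1 =P y.1 :> nat) => [e|ne].
  rewrite e ry addn1 ltnS [RHS]leq_eqVlt; congr (_ || _).
  by apply/eqP/eqP => [->//|]; apply: cell_inj.
by rewrite addn0; case: eqP => // xy; case: ne; rewrite xy.
Qed.

Lemma lin_uniq L r : lin L r -> uniq L.
Proof.
elim=> {L r} [r r0|y L r r' lL IH _ ry r'E] //=.
by rewrite IH (lin_mem _ lL) ry ltnn.
Qed.

(** Induction on the number of cells, removing the last cell of the last nonempty row. *)
Lemma lin_exists r : decr r -> (forall i, d <= i -> r i = 0) -> (forall i, r i <= c) ->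
  exists L, lin L r.
Proof.
have [m] := ubnP (\sum_(i < d) r i); elim: m r => // m IH r rm dr r0 rc.
have [r00|r0pos] := posnP (r 0).
  by exists [::]; constructor => i; have := dr 0 i; lia.
have [p /andP[rp rp1]] : exists p, (0 < r p) && (r p.+1 == 0).
  have : r d = 0 by apply: r0.
  elim: d => [|e IHe] re; first by rewrite re in r0pos.
  have [re0|rep] := posnP (r e); first exact: IHe.
  by exists e; rewrite rep re.
have pd : p < d by rewrite ltnNge; apply/negP => /r0; lia.
have xc : (r p).-1 < c by have := rc p; lia.
pose r' i := r i - (i == p).
have [||||L lL] := IH r'.
- rewrite -ltnS; apply: leq_trans rm; rewrite ltnS.
  rewrite (bigD1 (Ordinal pd)) //= [X in _ < X](bigD1 (Ordinal pd)) //=.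
  rewrite /r' eqxx -addSn leq_add //; first lia.
  by apply: leq_sum => i _; exact: leq_subr.
- move=> i j ij; rewrite /r'; have := dr _ _ ij; case: (i =P p) => [ip|_]; last lia.
  case: (j =P p) => [->|jp]; first lia.
  by have := dr p.+1 j; lia.
- by move=> i di; rewrite /r' r0.
- by move=> i; rewrite /r'; have := rc i; lia.
exists ((Ordinal pd, Ordinal xc) :: L); apply: lin_cons lL _ _ _ => /=.
- by split=> // i ip; rewrite /r' eqxx; have := dr i p; lia.
- by rewrite /r' eqxx; lia.
- by move=> i; rewrite /r'; case: eqP => [->|]; lia.
Qed.

Lemma lin_cat L1 L2 r : lin (L1 ++ L2) r -> exists r', lin L2 r'.
Proof.
elim: L1 r => [|x L1 IH] r /=; first by exists r.
move=> lr; inversion lr; subst; exact: IH H1.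
Qed.

(** Free cells, active cells and moves relative to any row lengths [r], so that the ambient diagram
    can grow cell by cell; at [nth 0 lam] the relation [mv] unfolds to [emove]. *)
Definition fr r S i j := (j < r i) && ~~ memc S i j.

Definition act r S u :=
  [&& u \in S, fr r S u.1.+1 u.2, fr r S u.1 u.2.+1 & fr r S u.1.+1 u.2.+1].

Definition mv r : rel {set cellT} := fun S S' =>
  [exists u, exists v : cellT,
     [&& act r S u, (v.1 == u.1.+1 :> nat), (v.2 == u.2.+1 :> nat) &
         (S' == (S :\ u) :|: [set v]) || (S' == v |: S)]].

Lemma memcP S i j : reflect (exists2 x, x \in S & x.1 = i :> nat /\ x.2 = j :> nat) (memc S i j).
Proof.
apply: (iffP existsP) => [[x /and3P[xS /eqP<- /eqP<-]]|[x xS [<- <-]]]; exists x => //.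
by rewrite xS !eqxx.
Qed.

Lemma memcE S x : memc S x.1 x.2 = (x \in S).
Proof.
apply/memcP/idP => [[y yS [y1 y2]]|xS]; last by exists x.
by rewrite -(cell_inj y1 y2).
Qed.

Lemma memcU1 S x i j : memc (x |: S) i j = (x.1 == i :> nat) && (x.2 == j :> nat) || memc S i j.
Proof.
apply/memcP/orP => [[y]|[/andP[/eqP<- /eqP<-]|/memcP[y yS e]]].
- rewrite !inE => /orP[/eqP->|yS] [<- <-]; first by left; rewrite !eqxx.
  by right; rewrite memcE.
- by exists x; rewrite ?setU11.
- by exists y; rewrite // !inE yS orbT.
Qed.

Lemma memc_shapeN r i j : r i <= j -> ~~ memc (shape r) i j.
Proof. by move=> rj; apply/memcP => -[x]; rewrite inE => xr [xi xj]; move: xr; rewrite xi xj;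
  lia. Qed.

Lemma mv_next r S (b v : cellT) : (v.1 = b.1.+1 :> nat) -> (v.2 = b.2.+1 :> nat) ->
  b \notin S -> fr r S b.1.+1 b.2 -> fr r S b.1 b.2.+1 -> fr r S b.1.+1 b.2.+1 ->
  mv r (b |: S) (v |: S) /\ mv r (b |: S) (v |: (b |: S)).
Proof.
move=> v1 v2 bS f1 f2 f3.
have ac : act r (b |: S) b.
  rewrite /act setU11 /= /fr !memcU1 !negb_or.
  move: f1 f2 f3 => /andP[-> ->] /andP[-> ->] /andP[-> ->].
  by apply/and3P; split; lia.
split; apply/existsP; exists b; apply/existsP; exists v; rewrite ac v1 v2 !eqxx /= ?orbT //.
by rewrite setU1K // setUC eqxx.
Qed.

(* Once [b] leaves the last filled place of its diagonal, it can travel to any [x] further down. *)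
Lemma slide r S (b x : cellT) t : (x.1 = b.1 + t :> nat) -> (x.2 = b.2 + t :> nat) -> b \notin S ->
  (forall s, s < t -> [/\ fr r S (b.1 + s).+1 (b.2 + s), fr r S (b.1 + s) (b.2 + s).+1
     & fr r S (b.1 + s).+1 (b.2 + s).+1]) ->
  connect (mv r) (b |: S) (x |: S) /\
  (0 < t -> connect (mv r) (b |: S) (x |: (b |: S))).
Proof.
elim: t b S => [|t IH] b S x1 x2 bS fS.
  rewrite !addn0 in x1 x2; rewrite (cell_inj x1 x2); split=> //; exact: connect0.
have v1d : b.1.+1 < d by have := ltn_ord x.1; lia.
have v2c : b.2.+1 < c by have := ltn_ord x.2; lia.
pose v : cellT := (Ordinal v1d, Ordinal v2c).
have [f1 f2 f3] := fS 0 isT; rewrite !addn0 in f1 f2 f3.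
have [m1 m2] := @mv_next r S b v erefl erefl bS f1 f2 f3.
have vS : v \notin S by move: f3 => /andP[_];
  rewrite -[b.1.+1]/(nat_of_ord v.1) -[b.2.+1]/(nat_of_ord v.2) memcE.
have xv1 : x.1 = v.1 + t :> nat by rewrite x1 /= addnS.
have xv2 : x.2 = v.2 + t :> nat by rewrite x2 /= addnS.
split.
  apply: connect_trans (connect1 m1) _; apply: (IH v S xv1 xv2 vS _).1 => s st.
  by have := fS s.+1 st; rewrite !addnS.
(* One type II move keeps [b]; type I moves then carry the new cell [v] down to [x]. *)
move=> _; apply: connect_trans (connect1 m2) _.
have vbS : v \notin b |: S.
  by rewrite !inE negb_or vS andbT; apply/eqP => vb; have := congr1 (fun x : cellT => x.1 : nat) vb;
    rewrite /=; lia.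
apply: (IH v (b |: S) xv1 xv2 vbS _).1 => s st.
have := fS s.+1 st; rewrite /= !addnS !addSn /fr !memcU1 !negb_or.
by move=> [/andP[-> ->] /andP[-> ->] /andP[-> ->]]; split; lia.
Qed.

(** The new corner [x] lies outside the diagram [r], while the three cells that a move needs free
    lie inside it. *)
Lemma mv_lift r r' x S S' : decr r -> r x.1 = x.2 -> (forall i, r' i = r i + (i == x.1)) ->
  mv r S S' -> mv r' (x |: S) (x |: S').
Proof.
move=> dr rx r'E /existsP[u /existsP[v /and4P[/and4P[uS f1 f2 f3] v1 v2 S'E]]].
have F i j : fr r S i j -> fr r' (x |: S) i j.
  rewrite /fr memcU1 r'E negb_or => /andP[ji ->].
  rewrite andbT; apply/andP; split; first lia.
  by apply/negP => /andP[/eqP x1 /eqP x2]; move: ji; rewrite -x1 -x2 rx ltnn.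
have ux : u != x.
  by apply/eqP => ux; move: f2 => /andP[]; rewrite ux rx; lia.
apply/existsP; exists u; apply/existsP; exists v.
rewrite /act !inE uS orbT !F //= v1 v2 /=.
case/orP: S'E => /eqP->; apply/orP; [left|right]; apply/eqP/setP => y; rewrite !inE.
  by case: (y =P x) => //= ->; rewrite eq_sym ux.
by case: (y == x); case: (y == v).
Qed.

End Cells.

(** * Excited diagrams as subwords that build a partition *)

Section ExcitedWords.
Variables (d : nat) (lam : seq nat).
Local Notation c := (head 0 lam).
Local Notation cellT := (cell d c).
Implicit Types (r : nat -> nat) (S : {set cellT}) (L : seq cellT) (x y u v : cellT).

Local Notation wd S L := (word (@letter d lam) S L).

Lemma shape_add1 r r' x : r x.1 = x.2 -> (forall i, r' i = r i + (i == x.1)) ->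
  shape d lam r' = x |: shape d lam r.
Proof.
move=> rx r'E; apply/setP => y; rewrite !inE r'E; case: (y =P x) => [->|ne].
  by rewrite eqxx rx; lia.
case: (y.1 =P x.1 :> nat) => [e|_]; last by rewrite addn0.
rewrite e rx /= addn1 ltnS leq_eqVlt; case: eqP => // e2.
by case: ne; apply: cell_inj.
Qed.

(* A place [b] on the diagonal of the corner [x] of [r'] that is last
   occupied (or first free) there can be slid down to [x]. *)
Lemma slide_to_corner L r r' (rho : nat -> nat) (b x : cellT) : lin L r -> decr rho ->
  (forall i, rho i <= r i) -> corner d r x.1 -> r x.1 = x.2 ->
  (forall i, r' i = r i + (i == x.1)) ->
  letter b = letter x -> rho b.1 = b.2 -> (forall i, i < b.1 -> b.2 < rho i) ->
  connect (mv r') (b |: shape d lam rho) (x |: shape d lam rho) /\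
  (b != x -> connect (mv r') (b |: shape d lam rho) (x |: (b |: shape d lam rho))).
Proof.
move=> lL drho rhor [_ cx] rx r'E lbx rb crb.
have drr := lin_decr lL.
have {}cx i : i < x.1 -> x.2 < r i by rewrite -rx; exact: cx.
have xrho : rho x.1 <= x.2 by rewrite -rx.
have bx : b.1 <= x.1.
  rewrite leqNgt; apply/negP => xb; move: lbx (crb _ xb); rewrite /letter.
  by have := ltn_ord b.1; have := ltn_ord x.1; lia.
pose t := x.1 - b.1.
have x1 : x.1 = b.1 + t :> nat by rewrite /t; lia.
have x2 : x.2 = b.2 + t :> nat.
  by move: lbx; rewrite /letter /t; have := ltn_ord b.1; have := ltn_ord x.1; lia.
have bS : b \notin shape d lam rho by rewrite inE rb ltnn.
have [|s1 s2] := @slide d lam r' (shape d lam rho) b x t x1 x2 bS.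
  move=> s st; have h1 : x.2 < r (b.1 + s) by apply: cx; lia.
  have h2 : x.2 <= r (b.1 + s).+1 by rewrite -rx; apply: drr; lia.
  have h3 := drho b.1 (b.1 + s); have h4 := drho b.1 (b.1 + s).+1.
  have [m1 m2 m3] : [/\ ~~ memc (shape d lam rho) (b.1 + s).+1 (b.2 + s),
    ~~ memc (shape d lam rho) (b.1 + s) (b.2 + s).+1 &
    ~~ memc (shape d lam rho) (b.1 + s).+1 (b.2 + s).+1].
    by split; apply: memc_shapeN; lia.
  rewrite /fr m1 m2 m3 !andbT !r'E; split; lia.
split=> // bx'; apply: s2; rewrite lt0n; apply: contra bx' => /eqP t0.
by apply/eqP/cell_inj; lia.
Qed.

(** Induction along [L], translating the action of the last letter. A letter acting trivially
    becomes a type II move followed by type I moves; a letter adding a box becomes type I moves,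
    possibly none, along its diagonal. *)
Lemma hk_excited L r M S : lin L r -> hk d (d + c) (wd S L) M ->
  exists rho, [/\ decr rho, (forall i, rho i <= r i), agree (d + c) M (edge d rho)
    & connect (mv r) (shape d lam rho) (S :&: shape d lam r)].
Proof.
move=> lL; elim: lL M S => {L r} [r r0|x L r r' lL IH [xd cx] rx r'E] M S.
  move=> /= h; exists (fun=> 0); split=> //; first by rewrite edge_ground.
  have -> : S :&: shape d lam r = shape d lam (fun=> 0); last exact: connect0.
  by apply/setP => y; rewrite !inE r0 andbF.
have drr := lin_decr lL.
have drr' : decr r' by apply: (lin_decr (lin_cons lL (conj xd cx) rx r'E)).
have shr' := shape_add1 rx r'E.
have rr' i : r i <= r' i by rewrite r'E; lia.
have lift rho T : connect (mv r) (shape d lam rho) T ->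
    connect (mv r') (x |: shape d lam rho) (x |: T).
  by apply: connect_homo => S1 S2 m; apply: connect1; exact: mv_lift m.
have weak rho T : connect (mv r) (shape d lam rho) T -> connect (mv r') (shape d lam rho) T.
  apply: (@connect_homo _ _ _ _ id) => S1 S2 /existsP[u /existsP[v /and4P[ac v1 v2 E]]].
  apply: connect1; apply/existsP; exists u; apply/existsP; exists v; rewrite v1 v2 E !andbT.
  move: ac; rewrite /act /fr => /and4P[-> /andP[f1 ->] /andP[f2 ->] /andP[f3 ->]] /=.
  by rewrite !(leq_trans _ (rr' _)).
rewrite /word /=; case: (boolP (x \in S)) => xS; last first.
  move=> /IH[rho [h1 h2 h3 /weak h4]]; exists rho; split=> //.
    by move=> i; apply: leq_trans (rr' i).
  suff -> : S :&: shape d lam r' = S :&: shape d lam r by [].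
  by apply/setP => y; rewrite shr' !inE; case: (y =P x) => // ->; rewrite (negbTE xS).
have SE : S :&: shape d lam r' = x |: (S :&: shape d lam r).
  by apply/setP => y; rewrite shr' !inE; case: (y =P x) => // ->; rewrite xS.
rewrite SE /= => /andP[hvM /orP[]] /IH[rho [h1 h2 h3 /lift h4]].
  (* The letter acts trivially: [rho] already has a removable cell [b] on the diagonal of [x]. A
     copy of it slides to [x] while [b] stays. *)
  have hve : hv (letter x) (edge d rho).
    move: hvM; rewrite /hv !(agreeP _ _ _ h3) //; have := letter_lt x; lia.
  have rho0 i : d <= i -> rho i = 0 by move=> di; have := h2 i; rewrite (lin_out lL di); lia.
  have [p [pd kE rp rp1]] := edge_hv h1 rho0 hve.
  have pc : (rho p).-1 < c.
    by have := h2 p; have := lin_le p lL; lia.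
  pose b : cellT := (Ordinal pd, Ordinal pc).
  pose rho' i := rho i - (i == p).
  have drho' : decr rho'.
    move=> i j ij; rewrite /rho'; have := h1 _ _ ij; case: (i =P p) => [ip|_]; last lia.
    case: (j =P p) => [->|jp]; first lia.
    by have := h1 p.+1 j; rewrite ip; lia.
  have shb : shape d lam rho = b |: shape d lam rho'.
    apply: shape_add1 => [|i] /=; rewrite /rho' ?eqxx; first lia.
    by case: (i =P p) => [->|]; lia.
  exists rho; split=> //; first by move=> i; apply: leq_trans (rr' i).
  have [||||||||_ s2] := @slide_to_corner L r r' rho' b x lL => //=.
  - by move=> i; rewrite /rho'; have := h2 i; lia.
  - by rewrite {1}/letter /=; have := kE; lia.
  - by rewrite /rho' eqxx; lia.
  - by move=> i ip; rewrite /rho'; have := h1 i p; lia.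
  apply: connect_trans h4; rewrite shb; apply: s2.
  apply/eqP => bx; have := h2 p; have : x.1 = p :> nat by rewrite -bx.
  have : x.2 = (rho p).-1 :> nat by rewrite -bx.
  by move=> e1 e2; move: rx; rewrite e2 e1; lia.
(* The letter adds a cell [b] to [rho], and [b] itself slides to [x]. *)
have [p kE cp] : exists2 p, letter x = rho p + d - p.+1 & corner d rho p.
  move: (hv_dn (letter x) M) hvM; rewrite /hv => hd /andP[Mk Mk1].
  have kn := letter_lt x.
  apply: edge_vh => //; rewrite -(agreeP _ _ _ h3) /dn ?eqxx //; lia.
have [pd cp'] := cp.
have pc : rho p < c.
  have := cx; have := h2 p; have := h1 p x.1; have := h2 x.1; have := cp' x.1.
  by move: kE; rewrite /letter; have := ltn_ord x.1; have := ltn_ord x.2; lia.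
pose b : cellT := (Ordinal pd, Ordinal pc).
pose rho' i := rho i + (i == p).
have shb : shape d lam rho' = b |: shape d lam rho by apply: shape_add1.
have drho' : decr rho'.
  move=> i j ij; rewrite /rho'; have := h1 _ _ ij; case: (j =P p) => [jp|_]; last lia.
  case: (i =P p) => [|ip]; first lia.
  by have := cp' i; subst p; lia.
have px : p <= x.1.
  rewrite leqNgt; apply/negP => xb; move: (cp' _ xb); have := h2 x.1.
  by move: kE; rewrite /letter; have := ltn_ord x.1; lia.
exists rho'; split=> //.
- move=> i; rewrite /rho'; case: (i =P p) => [->|_]; last by rewrite addn0;
  apply: leq_trans (rr' i).
  move: px; rewrite leq_eqVlt => /orP[/eqP px|px].
    by rewrite r'E px eqxx leq_add2r.
  by have := cx _ px; have := rr' p; move: kE; rewrite /letter; have := ltn_ord x.1; lia.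
- have [hve dne] := edge_add1 h1 cp; move: hve dne; rewrite -kE -/rho' => hve dne.
  apply/agreeP => q qn; have := agreeP _ _ _ h3 _ qn; rewrite -dne /dn.
  move: hvM hve => /andP[/negbTE Mk Mk1] /andP[/negbTE ek ek1].
  case: (q =P letter x) => [->|_]; first by rewrite Mk ek.
  by case: (q =P (letter x).+1) => [->|_] //; rewrite Mk1 ek1.
have [||||||||s1 _] := @slide_to_corner L r r' rho b x lL => //=.
apply: connect_trans h4; rewrite shb; exact: s1.
Qed.

(** This is the claim for the starting diagram. Truncating [rho] by [r] lets the induction pass
    through the partial diagrams listed by tails of [L]. *)
Lemma shape_hk L r (rho : nat -> nat) : lin L r -> decr rho ->
  hk d (d + c) (wd (shape d lam rho) L) (edge d (fun i => minn (rho i) (r i))).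
Proof.
move=> lL drho; elim: lL => {L r} [r r0|x L r r' lL IH [xd cx] rx r'E] /=.
  apply/agreeP => p _; rewrite -edge_ground; congr (edge _ _ p).
  by apply: functional_extensionality => i; rewrite r0 minn0.
rewrite /word /= inE; case: ltnP => xr.
  pose m i := minn (rho i) (r i).
  have mE : (fun i => minn (rho i) (r' i)) = (fun i => m i + (i == x.1)).
    apply: functional_extensionality => i; rewrite /m r'E; case: eqP => [->|_]; lia.
  have dm : decr m.
    by move=> i j ij; rewrite /m; have := drho _ _ ij; have := lin_decr lL ij; lia.
  have cm : corner d m x.1.
    split=> // i ix; rewrite /m; have := cx _ ix; have := drho _ _ (ltnW ix); lia.
  have [h1 h2] := edge_add1 dm cm; have mx : m x.1 = x.2 by rewrite /m rx; lia.
  rewrite /= mE; move: h1 h2; rewrite mx -/(letter x) => -> -> /=.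
  by apply/orP; right; exact: IH.
have -> : (fun i => minn (rho i) (r' i)) = (fun i => minn (rho i) (r i)); last exact: IH.
by apply: functional_extensionality => i; rewrite r'E; case: eqP => [->|_]; lia.
Qed.

Lemma mvP r S S' : mv r S S' -> exists u v : cellT,
  [/\ u \in S, ~~ memc S u.1.+1 u.2, ~~ memc S u.1 u.2.+1, fr r S u.1.+1 u.2.+1 &
   [/\ v.1 = u.1.+1 :> nat, v.2 = u.2.+1 :> nat &
    (S' == (S :\ u) :|: [set v]) || (S' == v |: S)]].
Proof.
move=> /existsP[u /existsP[v /and4P[/and4P[uS /andP[_ f1] /andP[_ f2] f3] /eqP v1 /eqP v2 S'E]]].
by exists u, v.
Qed.

(** The cells [u] and [v] share a letter that commutes with the letters of [S] between them. A type
    I move thus carries the letter through the word, and a type II move doubles it, which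
    idempotence undoes. *)
Lemma mv_hk L r S S' M : lin L r -> mv r S S' ->
  hk d (d + c) (wd S L) M = hk d (d + c) (wd S' L) M.
Proof.
move=> lL /mvP[u [v [uS f1 f2 /andP[f3 f4] [v1 v2 S'E]]]].
have vL : v \in L by rewrite (lin_mem _ lL) v1 v2.
have vS : v \notin S by rewrite -memcE v1 v2.
have uv : u != v by apply: contraNneq vS => <-.
have uvl : letter u = letter v.
  by rewrite /letter v1 v2.
(* Later cells come first, so [L] will be split as [a ++ v :: b ++ u :: e]. *)
case/splitPr: vL lL => a rest lL; have [r1 l1] := lin_cat lL.
inversion l1 as [|v' rest' r1' r1'' lr [_ cv] rv r1E e1 e2]; subst v' rest' r1''.
have u_rest : u \in rest.
  by rewrite (lin_mem _ lr); have := cv u.1; rewrite rv v1 v2 => /(_ (leqnn _)); lia.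
case/splitPr: u_rest lL l1 lr => b e lL l1 lr.
have [r0 l0] := lin_cat lr.
(* Among the cells listed between [u] and [v], only the two neighbours of [u] that the move requires
   outside [S] could have an equal or adjacent letter. *)
have far1 y : y \in S -> y \in b ->
    ((letter u).+1 < letter y) || ((letter y).+1 < letter u).
  move=> yS yb; have : y \in b ++ u :: e by rewrite mem_cat yb.
  rewrite (lin_mem _ lr) => y1.
  have y0 : r0 y.1 <= y.2.
    rewrite leqNgt -(lin_mem _ l0); have := lin_uniq lr.
    by rewrite cat_uniq => /and3P[_ /hasPn h _]; apply/negP => /h; rewrite /= yb.
  have u0 : u.2 < r0 u.1 by rewrite -(lin_mem _ l0) mem_head.
  have n1 : ~ (y.1 = u.1 :> nat /\ y.2 = u.2.+1 :> nat).
    by move=> [e1 e2]; move: f2; rewrite -e1 -e2 memcE yS.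
  have n2 : ~ (y.1 = u.1.+1 :> nat /\ y.2 = u.2 :> nat).
    by move=> [e1 e2]; move: f1; rewrite -e1 -e2 memcE yS.
  have h1 := lin_decr l0 (i := y.1) (j := u.1); have h2 := lin_decr lr (i := v.1) (j := y.1).
  rewrite /letter; have := ltn_ord y.1; have := ltn_ord u.1; have := ltn_ord v.1.
  have [yu|uy] := leqP y.1 u.1; first by have := h1 yu; lia.
  by move: rv h2; rewrite v1 v2 => -> /(_ uy); have := ltn_ord v.1; rewrite v1; lia.
have far : all (fun l => ((letter u).+1 < l) || (l.+1 < letter u)) (wd S b).
  by apply/allP => l /mapP[y]; rewrite mem_filter => /andP[yS yb] ->; exact: far1.
have SS' y : y != u -> y != v -> (y \in S') = (y \in S).
  by move=> /negbTE yu /negbTE yv; case/orP: S'E => /eqP->; rewrite !inE ?yu ?yv ?orbF.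
have uL := lin_uniq lL.
have same X : all (fun y => (y != u) && (y != v)) X -> wd S' X = wd S X.
  move=> /allP h; apply: eq_word => y /h /andP[yu yv]; exact: SS'.
move: uL; rewrite cat_uniq /= has_cat mem_cat cat_uniq /= inE !negb_or.
move=> /and5P[_ /and4P[va _ ua _] /and3P[vb _ ve] _].
move=> /and3P[/andP[ub _] ue _].
have sa : wd S' a = wd S a.
  apply: same; apply/allP => y ya; apply/andP; split.
    by apply: contraNneq ua => <-.
  by apply: contraNneq va => <-.
have sb : wd S' b = wd S b.
  apply: same; apply/allP => y yb; apply/andP; split.
    by apply: contraNneq ub => <-.
  by apply: contraNneq vb => <-.
have se : wd S' e = wd S e.
  apply: same; apply/allP => y ye; apply/andP; split.
    by apply: contraNneq ue => <-.
  by apply: contraNneq ve => <-.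
rewrite !word_cat sa; apply: hk_cat => {}M.
have cons T y X : wd T (y :: X) = if y \in T then letter y :: wd T X else wd T X.
  by rewrite /word /=; case: ifP.
rewrite !cons !word_cat !cons sb se uS (negbTE vS) -uvl.
have vS' : v \in S' by case/orP: S'E => /eqP->; rewrite !inE eqxx ?orbT.
rewrite vS' (hk_move _ _ _ far); case: ifP => // _.
(* Type II: the word of [S'] has the letter twice, and idempotence supplies the second copy. *)
rewrite -[LHS]hk_idem; apply: (@hk_cat _ _ [:: letter u]) => {}M.
by rewrite (hk_move _ _ _ far).
Qed.

Lemma connect_hk L r (rho : nat -> nat) S : lin L r -> decr rho ->
  (forall i, rho i <= r i) -> connect (mv r) (shape d lam rho) S ->
  hk d (d + c) (wd S L) (edge d rho).
Proof.
move=> lL drho rr /connectP[p].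
have := shape_hk lL drho.
have -> : (fun i => minn (rho i) (r i)) = rho.
  by apply: functional_extensionality => i; apply/minn_idPl.
elim: p (shape d lam rho) => [|T p IH] S0 /= h; first by move=> _ ->.
by move=> /andP[m]; apply: IH; rewrite -(mv_hk _ lL m).
Qed.

End ExcitedWords.

(** * Labels of the steps *)

Section Localization.
Variables (d : nat) (lam : seq nat).
Local Notation c := (head 0 lam).
Local Notation cellT := (cell d c).
Implicit Types (r rho : nat -> nat) (S : {set cellT}) (L : seq cellT) (x y u v : cellT).

Lemma connect_mv_sub r S S' : S \subset shape d lam r -> connect (mv r) S S' ->
  S' \subset shape d lam r.
Proof.
move=> sS /connectP[p]; elim: p S sS => [|T p IH] S sS /=; first by move=> _ ->.
move=> /andP[/mvP[u [v [uS _ _ /andP[f _] [v1 v2 TE]]]]]; apply: IH.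
have vr : v \in shape d lam r by rewrite inE v1 v2.
case/orP: TE => /eqP->; rewrite subUset sub1set vr ?andbT //.
by apply: subset_trans sS; exact: subD1set.
Qed.

Lemma edge_corner rho i : decr rho -> i < d ->
  reflect (corner d rho i) (edge d rho (rho i + d - i.+1) && ~~ edge d rho (rho i + d - i.+1).+1).
Proof.
move=> dr id; set k := rho i + d - i.+1; apply: (iffP andP) => [[ek nek]|cr].
  have [p kE cp] := edge_vh dr ek nek.
  suff -> : i = p by []; have := cp.1; have [ip|pi|//] := ltngtP i p.
  - by have := dr _ _ (ltnW ip); lia.
  - by have := dr _ _ (ltnW pi); lia.
have [_ e] := edge_add1 dr cr; rewrite -e -/k /dn eqxx; split=> //; lia.
Qed.

Local Open Scope ring_scope.
Variable K : fieldType.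

(** Addable positions correspond to corner rows through the position of the vertical step of a
    row. *)
Lemma raises_edge (f : (nat -> bool) -> K) rho : decr rho -> (forall i, rho i <= c)%N ->
  raises (d + c) f (edge d rho) =
  \sum_(R : {set 'I_d} | [forall i in R, forall j : 'I_d, (j < i) ==> (rho i < rho j)]%N)
     f (edge d (fun i => rho i + nmem R i)%N).
Proof.
move=> dr rc.
have hn (i : 'I_d) : (rho i + d - i.+1 < d + c)%N by have := rc i; have := ltn_ord i; lia.
pose h (i : 'I_d) : 'I_(d + c) := Ordinal (hn i).
have hinj : injective h.
  move=> i j /(congr1 val) /= e; apply: val_inj => /=; have := ltn_ord i; have := ltn_ord j.
  have [ij|ji|//] := ltngtP i j.
  - by have := dr _ _ (ltnW ij); lia.
  - by have := dr _ _ (ltnW ji); lia.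
have hadd (i : 'I_d) : h i \in addable (d + c) (edge d rho) ->
    corner d rho i by rewrite inE => /(edge_corner dr (ltn_ord i)).
have sadd (A : {set 'I_(d + c)}) : A \subset addable (d + c) (edge d rho) -> h @: (h @^-1: A) = A.
  move=> sA; apply/setP => k; apply/imsetP/idP => [[i] |kA]; first by rewrite inE => ? ->.
  have := subsetP sA k kA; rewrite inE => /andP[/edgeP[i id kE] _].
  have e : k = h (Ordinal id) by apply: val_inj; rewrite /= kE.
  by exists (Ordinal id); rewrite ?inE -?e.
rewrite /raises (reindex_onto (fun R : {set 'I_d} => h @: R) (fun A : {set 'I_(d + c)} => h @^-1: A)) /=; last by move=> A /sadd.
have pre (R : {set 'I_d}) : h @^-1: (h @: R) = R.
  by apply/setP => i; rewrite inE mem_imset.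
have cP (R : {set 'I_d}) : reflect (forall i : 'I_d, i \in R -> corner d rho i)
   [forall i in R, forall j : 'I_d, (j < i) ==> (rho i < rho j)]%N.
  apply: (iffP 'forall_in_forallP) => H i iR.
    split=> // j ji; have jd : (j < d)%N by have := ltn_ord i; lia.
    by have /implyP := H i iR (Ordinal jd); exact.
  by move=> j; apply/implyP; have [_] := H i iR; exact.
apply: eq_big => [R|R /andP[sR _]].
  rewrite pre eqxx andbT; apply/subsetP/cP => [H i iR|H _ /imsetP[i iR ->]].
    by apply/hadd/H; rewrite imset_f.
  by rewrite inE; apply/(edge_corner dr (ltn_ord i)); exact: H.
congr f; apply: functional_extensionality => p; rewrite /raise.
have cR i : nmem R i -> corner d rho i.
  move=> iR; have id := nmem_lt iR; rewrite (nmem_ord _ id) in iR.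
  by apply: (hadd (Ordinal id)); apply: (subsetP sR); rewrite imset_f.
rewrite (edge_add p dr cR).
have E q : nmem (h @: R) q = [exists i : 'I_d, nmem R i && (q == rho i + d - i.+1)%N].
  apply/imageP/existsP => [[k /imsetP[i iR ->] ->]|[i]].
    by exists i; rewrite nmemE iR /=.
  by rewrite nmemE => /andP[iR /eqP->]; exists (h i); rewrite ?imset_f.
rewrite !E; congr (_ || _); case: p => [|p] /=.
  by symmetry; apply/existsP => -[i /andP[_]].
by apply: eq_existsb => i; rewrite eqSS.
Qed.

Variables (X Y : nat -> K).

Definition cellwt x : K := Y x.2 / X x.1 - 1.

Local Notation loc := (loc d (d + c) (@letter d lam) cellwt).

(* The vertical step of row [i] carries [X i], and the horizontal step of column [j],
   of height [i], carries [Y j]. *)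
Definition labelled r (Z : nat -> K) :=
  (forall i, (i < d)%N -> Z (r i + d - i.+1)%N = X i) /\
  (forall i j, (i <= d)%N -> (j < c)%N -> (forall i', i' < i -> j < r i')%N -> (r i <= j)%N ->
     Z (d + j - i)%N = Y j).

(** Adding a cell exchanges the vertical step of its row with the horizontal step of its column, and
    the labels move along. At the empty diagram the vertical steps are the first [d], which yields
    the product of all [X i]. *)
Lemma good_lin L r Z : lin L r -> (forall i, (i < d)%N -> X i != 0) -> labelled r Z ->
  good d (d + c) (@letter d lam) cellwt (\prod_(i < d) X i) Z L.
Proof.
move=> lL X0; elim: lL Z => {L r} [r r0|x L r r' lL IH [xd cx] rx r'E] Z [Zr Zc] /=.
  rewrite /wt /ground -big_mkcond /= -(big_ord_widen _ Z); last by rewrite leqW ?leq_addr.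
  (* The path starts at the bottom row, so the order of the rows is reversed. *)
  rewrite (reindex_inj rev_ord_inj) /=; apply: eq_bigr => i _.
  by rewrite -(Zr i) ?r0.
have drr := lin_decr lL.
have {}cx i : (i < x.1)%N -> (x.2 < r i)%N by rewrite -rx; exact: cx.
have x2c := ltn_ord x.2.
have kE : (letter x).+1 = (r' x.1 + d - x.1.+1)%N by rewrite r'E eqxx rx /letter; lia.
have kE' : letter x = (d + x.2 - x.1.+1)%N by rewrite /letter addnC.
have Zk1 : Z (letter x).+1 = X x.1 by rewrite kE Zr.
have Zk : Z (letter x) = Y x.2.
  rewrite kE' Zc //.
    by move=> i; rewrite ltnS r'E leq_eqVlt => /orP[/eqP->|ix]; [rewrite eqxx rx | have := cx _ ix];
      lia.
  by rewrite r'E; have := drr _ _ (leqnSn x.1); rewrite rx; lia.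
split; rewrite ?letter_lt ?Zk1 ?Zk ?X0 //; apply: IH; split.
  move=> i id; rewrite /swapf; case: (i =P x.1) => [->|ix].
    by rewrite rx -/(letter x) eqxx Zk1.
  have -> : (r i + d - i.+1 == letter x)%N = false.
    rewrite /letter; have [ix'|xi|//] := ltngtP i x.1.
    - by have := cx _ ix'; lia.
    - by have := drr _ _ (ltnW xi); rewrite rx; lia.
  have -> : (r i + d - i.+1 == (letter x).+1)%N = false.
    rewrite /letter; have [ix'|xi|//] := ltngtP i x.1.
    - by have := cx _ ix'; lia.
    - by have := drr _ _ (ltnW xi); rewrite rx; lia.
  by rewrite -(Zr i id) r'E (introF eqP ix) addn0.
move=> i j id jc ci ri; rewrite /swapf.
have xi : (x.1 < i)%N -> (j < x.2)%N by move=> /ci; rewrite rx.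
have ix : (i <= x.1)%N -> (x.2 <= j)%N by move=> /drr; rewrite rx; lia.
have ix' : (i < x.1)%N -> (x.2 < j)%N by move=> /cx; lia.
case: (j =P x.2) => [jx|jx].
  (* Before [x] is added, its column has height [x.1]. *)
  have -> : i = x.1 by lia.
  have -> : (d + j - x.1 = (letter x).+1)%N by rewrite /letter; lia.
  by rewrite eqxx jx; case: eqP => [|_]; rewrite ?Zk //; lia.
have ne : (d + j - i < letter x)%N || ((letter x).+1 < d + j - i)%N.
  rewrite /letter; have [/xi|/ix] := ltnP x.1 i; lia.
have -> : (d + j - i == letter x)%N = false by lia.
have -> : (d + j - i == (letter x).+1)%N = false by lia.
apply: Zc => // [i' ii'|]; first by rewrite r'E; have := ci _ ii'; lia.
by rewrite r'E; case: (i =P x.1) => [ie|_]; [move: ix; rewrite ie rx | ]; lia.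
Qed.

(** A set of cells inside [r] is reachable from [rho] exactly when its word builds [rho]; [edge_inj]
    recovers the row lengths from the edge word. *)
Lemma loc_edge L r rho : lin L r -> decr rho -> (forall i, rho i <= r i)%N ->
  loc L (edge d rho) = \sum_(S | connect (mv r) (shape d lam rho) S) \prod_(x in S) cellwt x.
Proof.
move=> lL drho rr; have lc i := lin_le i lL.
rewrite loc_expand ?(lin_uniq lL) //; last by apply/allP => x _; exact: letter_lt.
rewrite -big_mkcondr /=; apply: eq_bigl => S; apply/andP/idP => [[sS]|cS].
  move=> /(hk_excited lL)[rho' [dr' rr' ag cn]].
  have lbl (r1 : nat -> nat) : (forall i, r1 i <= r i)%N -> forall i, (i < d)%N ->
    (r1 i + d - i.+1 <= d + c)%N.
    by move=> h i id; have := h i; have := lc i; lia.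
  have e := edge_inj drho dr' (lbl _ rr) (lbl _ rr') ag.
  have -> : shape d lam rho = shape d lam rho' by apply/setP => x; rewrite !inE e.
  rewrite (_ : S = S :&: shape d lam r) //; apply/setP => x; rewrite !inE.
  by case: (boolP (x \in S)) => //= /(subsetP sS); rewrite (lin_mem _ lL).
split; last exact: connect_hk cS.
have : S \subset shape d lam r.
  by apply: connect_mv_sub cS; apply/subsetP => x; rewrite !inE => h; exact: leq_trans (rr _).
by move=> /subsetP sS; apply/subsetP => x /sS; rewrite inE (lin_mem _ lL).
Qed.

(** Subwords of [L] only build partitions inside [r]. The bound [c.+1] admits a row just grown past
    the last column and still keeps every vertical step at a position at most [d + c]. *)
Lemma loc_edge_out L r rho i : lin L r -> decr rho -> (forall i, rho i <= c.+1)%N ->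
  (i < d)%N -> (r i < rho i)%N -> loc L (edge d rho) = 0.
Proof.
move=> lL drho rc id ri; have lc j := lin_le j lL.
rewrite loc_expand ?(lin_uniq lL) //; last by apply/allP => x _; exact: letter_lt.
apply: big1 => S _; case: ifP => // /(hk_excited lL)[rho' [dr' rr' ag _]].
suff e : rho i = rho' i by move: ri; rewrite e ltnNge rr'.
apply: (edge_inj drho dr' _ _ ag) => // j jd; first by have := rc j; lia.
by have := rr' j; have := lc j; lia.
Qed.

End Localization.

(** * Peeling off the first layer of a tableau *)

Section Tableaux.
Variables (d : nat) (lam : seq nat).
Local Notation c := (head 0 lam).
Local Notation cellT := (cell d c).
Local Notation tab := (tabT d lam).
Implicit Types (mu : seq nat) (T : tab) (R : {set 'I_d}) (x y : cellT) (i j k : nat).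

Definition grow mu R := mkseq (fun i => nth 0 mu i + nmem R i) d.

Lemma SITP mu T : reflect
  [/\ forall x, (x \in skewc d lam mu) = (0 < T x),
      forall x y, x \in skewc d lam mu -> y \in skewc d lam mu -> x.1 = y.1 -> x.2 < y.2 ->
        T x < T y,
      forall x y, x \in skewc d lam mu -> y \in skewc d lam mu -> x.2 = y.2 -> x.1 < y.1 ->
        T x < T y &
      forall k, 0 < k <= mT T -> exists2 x, x \in skewc d lam mu & T x = k :> nat]
  (is_SIT mu T).
Proof.
apply: (iffP and4P) => [[/forallP h1 /forall_inP h2 /forall_inP h3 /forallP h4]|[h1 h2 h3 h4]];
  split.
- by move=> x; apply/eqP/h1.
- by move=> x y xs ys e lt; have /forall_inP/(_ y ys) := h2 x xs; rewrite e eqxx lt.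
- by move=> x y xs ys e lt; have /forall_inP/(_ y ys) := h3 x xs; rewrite e eqxx lt.
- move=> k km; have kl : k < (sumn lam).+1.
    move: km => /andP[_ /leq_ltn_trans]; apply; rewrite ltnS.
    by apply/bigmax_leqP => x _; rewrite -ltnS ltn_ord.
  have /implyP/(_ km)/exists_inP[x xs /eqP xk] := h4 (Ordinal kl).
  by exists x => //; rewrite xk.
- by apply/forallP => x; rewrite h1.
- apply/forall_inP => x xs; apply/forall_inP => y ys; apply/implyP => /andP[/eqP]; exact: h2.
- apply/forall_inP => x xs; apply/forall_inP => y ys; apply/implyP => /andP[/eqP]; exact: h3.
- apply/forallP => k; apply/implyP => /h4[x xs xk]; apply/exists_inP; exists x => //.
  by apply/eqP/val_inj.
Qed.

Lemma leq_mT T x : T x <= mT T.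
Proof. by rewrite /mT (leq_bigmax x). Qed.

Lemma mT_leq T m : (forall x, T x <= m) -> mT T <= m.
Proof. by move=> h; apply/bigmax_leqP. Qed.

Lemma mT_card mu T : is_SIT mu T -> mT T <= #|skewc d lam mu|.
Proof.
case/SITP=> _ _ _ h.
rewrite -[leqLHS](size_iota 1) cardE -(size_map (fun x => nat_of_ord (T x))).
apply: uniq_leq_size (iota_uniq _ _) _ => k; rewrite mem_iota => km.
have [|x xs xk] := h k; first by move: km; lia.
by apply/mapP; exists x; rewrite ?mem_enum.
Qed.

(** Inverse to lowering all entries by one: cells of the larger skew shape with value 0 receive the
    entry 1. *)
Definition shift_up mu T : tab := [ffun x => if x \in skewc d lam mu then inord (T x).+1 else ord0].

Definition shift_down T : tab := [ffun x => inord (T x).-1].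

Definition firsts T : {set 'I_d} := [set i | [exists x : cellT, (x.1 == i) && (T x == 1 :> nat)]].

Lemma shift_downE T x : shift_down T x = (T x).-1 :> nat.
Proof. by rewrite ffunE inordK //; have := ltn_ord (T x); lia. Qed.

Lemma firstsP T (i : 'I_d) : reflect (exists2 x : cellT, x.1 = i & T x = 1 :> nat) (i \in firsts T).
Proof.
rewrite inE; apply: (iffP existsP) => [[x /andP[/eqP xi /eqP Tx]]|[x xi Tx]]; exists x => //.
by rewrite xi Tx !eqxx.
Qed.

Lemma mem_skewc mu x : (x \in skewc d lam mu) = (nth 0 mu x.1 <= x.2 < nth 0 lam x.1).
Proof. by rewrite !inE /in_diag -leqNgt. Qed.

Lemma shift_upK mu T : is_SIT mu T -> shift_up mu (shift_down T) = T.
Proof.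
case/SITP=> h _ _ _; apply/ffunP => x; rewrite ffunE h; apply: val_inj.
case: posnP => Tx /=; first by rewrite Tx.
by rewrite shift_downE prednK // inord_val.
Qed.

Section Peel.
Variable mu : seq nat.

Definition layer R := [forall i in R, (nth 0 mu (val i) < nth 0 lam (val i)) &&
  [forall j : 'I_d, (j < i) ==> (nth 0 mu (val i) < nth 0 mu (val j))]].

Lemma layerP R : reflect (forall i : 'I_d, i \in R ->
  nth 0 mu i < nth 0 lam i /\ corner d (nth 0 mu) i)
  (layer R).
Proof.
apply: (iffP forall_inP) => [h i /h /andP[h1 /forallP h2]|h i /h[-> [_ h2]]].
  split=> //; split=> // j ji; have jd : j < d by have := ltn_ord i; lia.
  exact: (implyP (h2 (Ordinal jd))).
by apply/forallP => j; apply/implyP => /h2.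
Qed.

Lemma SIT_first T y : is_SIT mu T -> T y = 1 :> nat -> y.2 = nth 0 mu y.1 :> nat.
Proof.
case/SITP=> h1 h2 _ _ Ty; have : y \in skewc d lam mu by rewrite h1 Ty.
rewrite mem_skewc => /andP[]; rewrite leq_eqVlt => /orP[/eqP-> //|lt ly].
have bc : nth 0 mu y.1 < c by have := ltn_ord y.2; lia.
pose b : cellT := (y.1, Ordinal bc).
have bs : b \in skewc d lam mu by rewrite mem_skewc /= leqnn; lia.
have := h2 b y bs _ erefl lt; rewrite Ty h1 Ty => /(_ isT).
by move: bs; rewrite h1; lia.
Qed.

Lemma firstsE T x : is_SIT mu T ->
  (T x == 1 :> nat) = (x.1 \in firsts T) && (x.2 == nth 0 mu x.1 :> nat).
Proof.
move=> sT; apply/eqP/andP => [Tx|[/firstsP[y y1 Ty] /eqP x2]].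
  by split; [apply/firstsP; exists x | rewrite (SIT_first sT Tx)].
suff -> : x = y by rewrite Ty.
by apply: cell_inj; rewrite ?y1 // x2 (SIT_first sT Ty) y1.
Qed.

Lemma firsts_neq0 T : is_SIT mu T -> skewc d lam mu != set0 -> firsts T != set0.
Proof.
move=> sT /set0Pn[y ys]; have [h1 _ _ h4] := SITP _ _ sT.
have [|x xs Tx] := h4 1; first by apply: leq_trans (leq_mT T y); rewrite -h1.
by apply/set0Pn; exists x.1; apply/firstsP; exists x.
Qed.

Lemma mT_down T : is_SIT mu T -> skewc d lam mu != set0 -> mT T = (mT (shift_down T)).+1.
Proof.
move=> sT /set0Pn[y ys]; have [h1 _ _ _] := SITP _ _ sT.
have Ty : 0 < T y by rewrite -h1.
apply/eqP; rewrite eqn_leq; apply/andP; split.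
  apply: mT_leq => x; have := leq_mT (shift_down T) x; rewrite shift_downE; lia.
suff : mT (shift_down T) <= (mT T).-1 by have := leq_mT T y; lia.
by apply: mT_leq => x; rewrite shift_downE; have := leq_mT T x; lia.
Qed.

Hypothesis dlam : decr (nth 0 lam).

Lemma lam_le i : nth 0 lam i <= c.
Proof. by rewrite -nth0; exact: dlam. Qed.

(** A cell of the skew shape above an entry 1 would carry a smaller positive entry. *)
Lemma layer_firsts T : is_SIT mu T -> layer (firsts T).
Proof.
move=> sT; have [h1 _ h3 _] := SITP _ _ sT.
apply/layerP => i /firstsP[x <- Tx].
have x2 := SIT_first sT Tx; have xs : x \in skewc d lam mu by rewrite h1 Tx.
have := xs; rewrite mem_skewc x2 leqnn /= => xl; split=> //; split=> // j jx.
rewrite ltnNge; apply/negP => mj; have jd : j < d by have := ltn_ord x.1; lia.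
pose b : cellT := (Ordinal jd, x.2).
have bs : b \in skewc d lam mu.
  rewrite mem_skewc /= x2 mj /=; apply: leq_trans xl _; exact: dlam (ltnW jx).
by have := h3 b x bs xs erefl jx; rewrite Tx; move: bs; rewrite h1; lia.
Qed.

Hypothesis slam : size lam <= d.

Lemma lam_out i : d <= i -> nth 0 lam i = 0.
Proof. by move=> di; rewrite nth_default //; exact: leq_trans di. Qed.

Lemma card_lam : #|diag d lam lam| = sumn lam.
Proof.
rewrite -sum1_card (eq_bigl (fun x : 'I_d * 'I_c => true && (x.2 < nth 0 lam x.1))); last first.
  by move=> x; rewrite inE.
rewrite -(pair_big_dep predT (fun (i : 'I_d) (j : 'I_c) => j < nth 0 lam i) (fun _ _ => 1)) /=.
rewrite sumnE (big_nth 0) (big_nat_widen _ _ d) // big_mkord /= [RHS]big_mkcond /=.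
apply: eq_bigr => i _; rewrite -(big_ord_widen _ (fun=> 1)) ?lam_le // sum1_card card_ord.
by case: ltnP => // /(nth_default 0).
Qed.

Hypothesis mulam : forall i, nth 0 mu i <= nth 0 lam i.

Lemma nth_grow R i : nth 0 (grow mu R) i = nth 0 mu i + nmem R i.
Proof.
case: (ltnP i d) => di; first by rewrite nth_mkseq.
rewrite nth_default ?size_mkseq //; have := mulam i; rewrite lam_out //.
by case: (boolP (nmem R i)) => [/nmem_lt|]; lia.
Qed.

Lemma mem_skewc_grow R x : x \in skewc d lam (grow mu R) =
  (x \in skewc d lam mu) && ~~ ((x.1 \in R) && (x.2 == nth 0 mu x.1 :> nat)).
Proof. by rewrite !mem_skewc nth_grow nmemE; case: (x.1 \in R) => /=; lia. Qed.

Lemma SIT_down T : is_SIT mu T -> is_SIT (grow mu (firsts T)) (shift_down T).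
Proof.
move=> sT; have [h1 h2 h3 h4] := SITP _ _ sT.
have E x : (x \in skewc d lam (grow mu (firsts T))) = (1 < T x).
  by rewrite mem_skewc_grow -firstsE // h1; lia.
apply/SITP; split.
- by move=> x; rewrite E shift_downE; lia.
- move=> x y; rewrite !E !shift_downE => xs ys e l.
  by have := h2 x y _ _ e l; rewrite !h1; lia.
- move=> x y; rewrite !E !shift_downE => xs ys e l.
  by have := h3 x y _ _ e l; rewrite !h1; lia.
- move=> k /andP[k0 km]; have [|x xs Tx] := h4 k.+1.
    have [s0|s0] := eqVneq (skewc d lam mu) set0; last by rewrite (mT_down sT s0); lia.
    move: km; suff -> : mT (shift_down T) = 0 by lia.
    apply/eqP; rewrite -leqn0; apply: mT_leq => x; rewrite shift_downE.
    by have := h1 x; rewrite s0 inE; lia.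
  by exists x; rewrite ?E ?shift_downE Tx.
Qed.

Lemma SIT_up R T : layer R -> R != set0 -> is_SIT (grow mu R) T ->
  [/\ is_SIT mu (shift_up mu T), firsts (shift_up mu T) = R & shift_down (shift_up mu T) = T].
Proof.
move=> /[dup] lR /layerP LR Rn0 sT; have [h1 h2 h3 h4] := SITP _ _ sT.
have /set0Pn[i0 i0R] := Rn0.
have [i0l _] := LR _ i0R.
have bc : nth 0 mu i0 < c by have := lam_le i0; lia.
pose b : cellT := (i0, Ordinal bc).
have bs : b \in skewc d lam mu by rewrite mem_skewc /= leqnn.
have bns : b \notin skewc d lam (grow mu R) by rewrite mem_skewc_grow /= i0R eqxx andbF.
(* Room for the raised entries: the skew shape of [grow mu R] misses the cell [b] of [lam], so
   [inord] does not overflow. *)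
have mlt : mT T < sumn lam.
  apply: leq_ltn_trans (mT_card sT) _; rewrite -card_lam; apply: proper_card.
  apply/properP; split; first by apply/subsetP => x; rewrite !inE => /andP[].
  by exists b => //; rewrite inE /in_diag.
have ssub x : x \in skewc d lam (grow mu R) -> x \in skewc d lam mu.
  by rewrite mem_skewc_grow => /andP[].
have U x : shift_up mu T x = (if x \in skewc d lam mu then (T x).+1 else 0) :> nat.
  rewrite ffunE; case: ifP => // _; rewrite inordK //; have := leq_mT T x; lia.
have Uin x : x \in skewc d lam mu -> shift_up mu T x = (T x).+1 :> nat by rewrite U => ->.
have T0 x : x \notin skewc d lam (grow mu R) -> T x = 0 :> nat by rewrite h1; lia.
have new x : x \in skewc d lam mu -> x \notin skewc d lam (grow mu R) ->
   corner d (nth 0 mu) x.1 /\ x.2 = nth 0 mu x.1 :> nat.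
  move=> xs; rewrite mem_skewc_grow xs /= negbK => /andP[/LR[_ cx] /eqP x2].
  by split.
have s1 : is_SIT mu (shift_up mu T).
  apply/SITP; split.
  - by move=> x; rewrite U; case: ifP.
  - move=> x y xs ys e lt; rewrite !Uin // ltnS.
    case: (boolP (y \in skewc d lam (grow mu R))) => yn; last first.
      (* A new cell is the first of its row in the skew shape, so none lies to its left. *)
      by have [_ y2] := new y ys yn; move: xs; rewrite mem_skewc e; lia.
    case: (boolP (x \in skewc d lam (grow mu R))) => xn; first exact: h2.
    by rewrite (T0 x xn) -h1.
  - move=> x y xs ys e lt; rewrite !Uin // ltnS.
    case: (boolP (y \in skewc d lam (grow mu R))) => yn; last first.
      (* A new cell is a corner of [mu], so the cells above it belong to [mu]. *)
      have [[_ cy] y2] := new y ys yn; have := cy _ lt.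
      by move: xs; rewrite mem_skewc e y2; lia.
    case: (boolP (x \in skewc d lam (grow mu R))) => xn; first exact: h3.
    by rewrite (T0 x xn) -h1.
  - move=> [|[|k]] // km; first by exists b => //; rewrite Uin // T0.
    have [|x xs Tx] := h4 k.+1; last by exists x; rewrite ?ssub // Uin ?ssub // Tx.
    have : mT (shift_up mu T) <= (mT T).+1.
      by apply: mT_leq => x; rewrite U; case: ifP => // _; rewrite ltnS leq_mT.
    by move: km; lia.
split=> //; last first.
  apply/ffunP => x; apply: val_inj; rewrite /= shift_downE U; case: ifP => // xs.
  by rewrite T0 //; apply: contraFN xs; exact: ssub.
apply/setP => i; apply/idP/idP => [|iR].
  move=> /firstsP[x <-]; rewrite U; case: ifP => // xs [Tx].
  have : x \notin skewc d lam (grow mu R) by rewrite h1 Tx.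
  by rewrite mem_skewc_grow xs /= negbK => /andP[].
have [il _] := LR _ iR; have ic : nth 0 mu i < c by have := lam_le i; lia.
apply/firstsP; exists (i, Ordinal ic); rewrite //= Uin.
  by rewrite T0 // mem_skewc_grow /= iR eqxx andbF.
by rewrite mem_skewc /= leqnn.
Qed.

Lemma nu_first T i : is_SIT mu T -> nu mu T 1 i = nth 0 mu i.
Proof.
case/SITP=> h1 _ _ _; rewrite /nu (_ : [set x in _ | _] = set0) ?cards0 ?addn0 //.
by apply/setP => x; rewrite in_set0 in_set h1; apply/negbTE; lia.
Qed.

(** The cells with entry 1 are absorbed into [grow mu (firsts T)], and every other entry drops by
    one. *)
Lemma nu_down T k i : is_SIT mu T -> 0 < k -> i < d ->
  nu mu T k.+1 i = nu (grow mu (firsts T)) (shift_down T) k i.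
Proof.
move=> sT k0 id; have [h1 _ _ _] := SITP _ _ sT.
rewrite /nu nth_grow -addnA; congr (_ + _).
set B := [set x in skewc d lam mu | _].
set A := [set x in skewc d lam (grow mu (firsts T)) | _].
have E x : (x \in skewc d lam (grow mu (firsts T))) = (1 < T x).
  by rewrite mem_skewc_grow -firstsE // h1; lia.
have inB x : (x \in B) = [&& 0 < T x, x.1 == i :> nat & T x < k.+1] by rewrite in_set h1.
have inA x : (x \in A) = [&& 1 < T x, x.1 == i :> nat & (T x).-1 < k].
  by rewrite in_set E shift_downE.
rewrite (nmem_ord _ id); case: (boolP (_ \in _)) => iR.
  have [il _] := layerP _ (layer_firsts sT) _ iR.
  have ic : nth 0 mu i < c by have := lam_le i; move: il => /=; lia.
  pose b : cellT := (Ordinal id, Ordinal ic).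
  have Tb : T b = 1 :> nat by apply/eqP; rewrite firstsE //= iR eqxx.
  have bA : b \notin A by rewrite inA Tb.
  rewrite -[1 + _]/(true + #|A|) -bA -cardsU1;
    suff EB x : (x \in B) = (x \in b |: A) by exact: eq_card EB.
  rewrite in_setU1 inA inB.
  case: (x =P b) => [->|ne]; first by rewrite Tb eqxx.
  have : T x != 1 :> nat \/ x.1 != i :> nat.
    case: (x.1 =P i :> nat) => [xi|]; last by right.
    left; rewrite firstsE //; apply/negP => /andP[_ /eqP x2]; apply: ne.
    by apply: cell_inj => //=; rewrite x2 xi.
  by move=> [] ; lia.
rewrite add0n; suff EB x : (x \in B) = (x \in A) by exact: eq_card EB.
rewrite inA inB.
have : T x != 1 :> nat \/ x.1 != i :> nat.
  case: (x.1 =P i :> nat) => [xi|]; last by right.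
  left; rewrite firstsE //; apply/negP => /andP[x1 _]; case/negP: iR.
  by rewrite (_ : Ordinal id = x.1) //; apply: val_inj.
by move=> []; lia.
Qed.

Local Open Scope ring_scope.
Variables (K : fieldType) (ratio : (nat -> nat) -> K).
Hypothesis ratio_ext : forall f g : nat -> nat, (forall i, (i < d)%N -> f i = g i) ->
  ratio f = ratio g.

(** Tableaux are grouped by the rows holding an entry 1. The factor at [k = 1] depends on [mu] only,
    and lowering the entries shifts the index of the others. *)
Lemma SIT_peel : skewc d lam mu != set0 ->
  \sum_(T in SIT d lam mu) \prod_(1 <= k < (mT T).+1) (ratio (nu mu T k) - 1)^-1 =
  (ratio (nth 0%N mu) - 1)^-1 * \sum_(R : {set 'I_d} | layer R && (R != set0))
    \sum_(T in SIT d lam (grow mu R)) \prod_(1 <= k < (mT T).+1) (ratio (nu (grow mu R) T k) - 1)^-1.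
Proof.
move=> s0; rewrite (partition_big firsts (fun R => layer R && (R != set0))) /=; last first.
  by move=> T; rewrite inE => sT; rewrite layer_firsts ?firsts_neq0.
rewrite mulr_sumr; apply: eq_bigr => R /andP[lR Rn0].
rewrite (reindex_onto (shift_up mu) shift_down) /=; last first.
  by move=> T /andP[]; rewrite inE => sT _; exact: shift_upK.
rewrite mulr_sumr; apply: eq_big => [T|T].
  rewrite !inE; apply/idP/idP => [/andP[/andP[sT /eqP fT] /eqP dT]|sT].
    by rewrite -dT -fT; exact: SIT_down.
  by have [-> -> ->] := SIT_up lR Rn0 sT; rewrite !eqxx.
rewrite inE => /andP[/andP[sT /eqP fT] /eqP dT].
rewrite (mT_down sT s0) dT big_ltn // (ratio_ext (f := nu mu (shift_up mu T) 1) (g := nth 0%N mu));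
  last first.
  by move=> i _; exact: nu_first.
congr (_ * _); rewrite big_add1 /= !big_nat; apply: eq_bigr => k /andP[k0 _].
congr (_ - _)^-1; apply: ratio_ext => i id.
by rewrite (nu_down sT k0 id) fT dT.
Qed.

End Peel.
End Tableaux.

(** * Specialization to hooks *)

Lemma part_decr l : is_part l -> decr (nth 0 l).
Proof.
move=> /andP[sl _] i j ij; case: (ltnP j (size l)) => jl; last by rewrite nth_default.
have gT : transitive geq by move=> a b e ba ae; exact: leq_trans ae ba.
exact: (sorted_leq_nth gT leqnn 0 sl i j (leq_ltn_trans ij jl) jl ij).
Qed.

Lemma conj_partE l i j : decr (nth 0 l) -> (forall i', i' < i -> j < nth 0 l i') ->
  nth 0 l i <= j -> conj_part l j = i.
Proof.
move=> dl h1 h2; have il : i <= size l.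
  rewrite leqNgt; apply/negP => li; have := h1 _ li; rewrite nth_default //; lia.
rewrite /conj_part -[l](cat_take_drop i) count_cat.
have -> : count (fun x => j < x) (take i l) = i.
  rewrite -[RHS](size_takel il); apply/eqP; rewrite -all_count.
  by apply/(all_nthP 0) => m; rewrite size_takel // => mi; rewrite nth_take ?h1.
rewrite (@eq_in_count _ _ pred0) ?count_pred0 ?addn0 // => x /(nthP 0)[m ml <-].
by rewrite nth_drop /=; have := dl i (i + m) (leq_addr _ _); lia.
Qed.

Lemma conj_part_ex d l j : size l <= d -> exists2 h, h <= d &
  (forall i', i' < h -> j < nth 0 l i') /\ nth 0 l h <= j.
Proof.
move=> sl; have ex : exists h, nth 0 l h <= j by exists d; rewrite nth_default.
case: (ex_minnP ex) => h hj hmin; exists h; first by apply: hmin; rewrite nth_default.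
by split=> // i' ih; rewrite ltnNge; apply/negP => /hmin; lia.
Qed.

(** Turns a factor of the hook product into the inverse of a cell weight. *)
Lemma inv_weight (K : fieldType) (X Y h b : K) : X != 0%R -> h != 0%R -> b != 0%R ->
  (Y - X = - b * h -> (- b)^-1 * (X / h) = (Y / X - 1)^-1)%R.
Proof.
move=> X0 h0 b0 e; have -> : (Y / X - 1 = (- b * h) / X)%R by rewrite -e; field.
by field; rewrite h0 X0 ?oppr_eq0 b0.
Qed.

Section EdgeWeights.
Variable d : nat.

Lemma grow_decr (mu : seq nat) (R : {set 'I_d}) : decr (nth 0 mu) ->
  [forall i in R, forall j : 'I_d, (j < i) ==> (nth 0 mu i < nth 0 mu j)] ->
  decr (fun i => nth 0 mu i + nmem R i).
Proof.
move=> dm /forall_inP H i j ij; have := dm _ _ ij.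
case: (boolP (nmem R j)) => [jR|]; last lia.
have jd := nmem_lt jR; have jR' := jR; rewrite (nmem_ord _ jd) in jR'.
move: ij; rewrite leq_eqVlt => /orP[/eqP->|ij]; first by rewrite jR; lia.
have id : i < d := ltn_trans ij jd.
by have /forallP/(_ (Ordinal id))/implyP/(_ ij) /= := H _ jR'; lia.
Qed.

Local Open Scope ring_scope.

Lemma wt_edge (K : fieldType) n (Z : nat -> K) r : decr r -> (forall i, i < d ->
  r i + d - i.+1 <= n)%N ->
  wt n Z (edge d r) = \prod_(i < d) Z (r i + d - i.+1)%N.
Proof.
move=> dr rn; pose h (i : 'I_d) : 'I_n.+1 := inord (r i + d - i.+1).
have hE (i : 'I_d) : h i = (r i + d - i.+1)%N :> nat by rewrite inordK // ltnS rn.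
rewrite /wt -big_mkcond /= (eq_bigl (fun p => p \in h @: [set: 'I_d])).
  rewrite big_imset /=; first by apply: eq_big => [i|i _]; rewrite ?inE ?hE.
  move=> i j _ _ /(congr1 val); rewrite /= !hE => e; apply: val_inj => /=.
  have := ltn_ord i; have := ltn_ord j; have [ij|ji|//] := ltngtP i j.
  - by have := dr _ _ (ltnW ij); lia.
  - by have := dr _ _ (ltnW ji); lia.
move=> p; apply/edgeP/imsetP => [[i id pE]|[i _ ->]].
  by exists (Ordinal id); rewrite ?inE //; apply: val_inj; rewrite /= hE.
by exists i; rewrite ?hE.
Qed.

End EdgeWeights.

(** * Labels as rational functions in beta, and the final induction *)

Section Final.
Variables (d : nat) (lam : seq nat).
Hypotheses (plam : is_part lam) (slam : size lam <= d).
Local Notation c := (head 0 lam).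
Local Notation cellT := (cell d c).
Implicit Types (mu : seq nat) (R : {set 'I_d}) (x y : cellT) (i j k : nat).

Let dlam := part_decr plam.

Lemma skewc0P mu : (forall i, nth 0 mu i <= nth 0 lam i) -> skewc d lam mu = set0 ->
  forall i, i < d -> nth 0 mu i = nth 0 lam i.
Proof.
move=> ml s0 i id; apply/eqP; rewrite eqn_leq ml leqNgt /=; apply/negP => lt.
have ic : nth 0 mu i < c by have := lam_le dlam i; lia.
by have := in_set0 ((Ordinal id, Ordinal ic) : cellT); rewrite -s0 mem_skewc /= leqnn lt.
Qed.

Local Open Scope ring_scope.
Local Notation b := beta.

Definition steplab p : RF := 1 + b * p.+1%:R.
Definition rowlab i : RF := 1 + b * (nth 0%N lam i + d - i)%:R.
Definition collab j : RF := 1 + b * (d + j.+1 - conj_part lam j)%:R.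

Lemma step_tofrac p : 1 + b * p%:R = @FracField.tofrac _ (1 + 'X * p%:R : {poly rat}).
Proof. by rewrite rmorphD rmorph1 rmorphM rmorph_nat. Qed.

(** The value at [beta = 0] is 1. *)
Lemma step_neq0 p : 1 + b * p%:R != 0.
Proof.
rewrite step_tofrac tofrac_eq0; apply/eqP => /(congr1 (fun q : {poly rat} => q.[0])).
by rewrite !hornerE ?mul0r ?addr0 => /eqP; rewrite oner_eq0.
Qed.

Lemma beta_neq0 : b != 0.
Proof. by rewrite tofrac_eq0 polyX_eq0. Qed.

Lemma natRF_neq0 p : (0 < p)%N -> p%:R != 0 :> RF.
Proof.
move=> p0; rewrite -(rmorph_nat (@FracField.tofrac {poly rat})) tofrac_eq0.
by rewrite -polyC_natr polyC_eq0 pnatr_eq0 -lt0n.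
Qed.

(** At [beta = 1] these become products of positive integers, strictly monotone in each factor. This
    is what makes [ratio - 1] invertible. *)
Lemma prod_step_inj (f g : 'I_d -> nat) : (forall i : 'I_d, f i <= g i)%N ->
  \prod_(i < d) (1 + b * (f i)%:R) = \prod_(i < d) (1 + b * (g i)%:R) -> f =1 g.
Proof.
move=> fg; have F (h : 'I_d -> nat) :
    \prod_(i < d) (1 + b * (h i)%:R) = @FracField.tofrac _ (\prod_(i < d) (1 + 'X * (h i)%:R : {poly rat})).
  by rewrite rmorph_prod; apply: eq_bigr => i _; exact: step_tofrac.
rewrite !F => /eqP.
rewrite tofrac_eq => /eqP /(congr1 (fun q : {poly rat} => q.[1])).
rewrite !horner_prod.
have E (h : 'I_d -> nat) : \prod_(i < d) (1 + 'X * (h i)%:R : {poly rat}).[1] = (\prod_(i < d) (h i).+1)%:R.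
  rewrite natr_prod; apply: eq_bigr => i _.
  by rewrite -polyC_natr !hornerE -natr1 addrC.
rewrite !E => /eqP; rewrite eqr_nat => /eqP e i; apply/eqP; rewrite eqn_leq fg leqNgt /=.
apply/negP => lt; have : (\prod_(i < d) (f i).+1 < \prod_(i < d) (g i).+1)%N.
  rewrite (bigD1 i) //= [X in (_ < X)%N](bigD1 i) //=.
  apply: (@leq_trans ((g i).+1 * \prod_(j < d | j != i) (f j).+1)).
    by rewrite ltn_pmul2r // prodn_gt0.
  by rewrite leq_mul2l leq_prod ?orbT // => j _; rewrite ltnS fg.
by rewrite e ltnn.
Qed.

Lemma labelled_lam : @labelled d lam _ rowlab collab (nth 0%N lam) steplab.
Proof.
split=> [i id|i j id jc h1 h2]; rewrite /steplab /rowlab /collab.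
  by congr (_ + _ * _%:R); lia.
by rewrite (conj_partE dlam h1 h2); congr (_ + _ * _%:R); lia.
Qed.

Lemma hook_lab x : x \in diag d lam lam ->
  (0 < hook lam x.1 x.2)%N /\ collab x.2 - rowlab x.1 = - b * (hook lam x.1 x.2)%:R.
Proof.
rewrite inE /in_diag => xl; have [h hd [h1 h2]] := conj_part_ex x.2 slam.
have xh : (x.1 < h)%N.
  by rewrite ltnNge; apply/negP => /dlam hx; have := leq_trans xl (leq_trans hx h2); rewrite ltnn.
rewrite /collab /rowlab /hook (conj_partE dlam h1 h2); split; first by rewrite addn1.
have -> : (nth 0%N lam x.1 - x.2.+1 + (h - x.1.+1) + 1 =
   (nth 0%N lam x.1 + d - x.1) - (d + x.2.+1 - h))%N by have := ltn_ord x.1; lia.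
set P := (nth 0%N lam x.1 + d - x.1)%N; set Q := (d + x.2.+1 - h)%N.
have QP : (Q <= P)%N by rewrite /P /Q; have := ltn_ord x.1; lia.
by rewrite (natrB _ QP); ring.
Qed.

Local Notation wgt := (@cellwt d lam _ rowlab collab).
Local Notation loc := (loc d (d + c) (@letter d lam) wgt).

Lemma row_neq0 i : rowlab i != 0. Proof. exact: step_neq0. Qed.

(** The factor depending on [lam] only that relates the hook form to the sum of products of [wgt]
    over [D]. *)
Definition diag_const : RF := \prod_(x in diag d lam lam) (wgt x)^-1.

Lemma wgt_neq0 x : x \in diag d lam lam -> wgt x != 0.
Proof.
move=> /hook_lab[h0 hE]; rewrite /cellwt -(divff (row_neq0 x.1)) -mulrBl hE.
by rewrite mulf_neq0 ?invr_eq0 ?row_neq0 // mulf_neq0 ?oppr_eq0 ?beta_neq0 ?natRF_neq0.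
Qed.

Lemma term_excited (D : {set cellT}) : D \subset diag d lam lam ->
  (- b) ^ ((#|D| : int) - (sumn lam : int)) *
       \prod_(x in diag d lam lam :\: D)
          ((b * (nth 0%N lam x.1 + d - x.1)%N%:R + 1) / (hook lam x.1 x.2)%:R)
  = diag_const * \prod_(x in D) wgt x.
Proof.
move=> sD.
have -> : (#|D| : int) - (sumn lam : int) = - (#|diag d lam lam :\: D| : int).
  by rewrite -(card_lam dlam slam) -(cardsID D (diag d lam lam)) (setIidPr sD); lia.
rewrite -exprnN -exprVn -prodr_const -big_split /=.
rewrite /diag_const [in RHS](big_setID D) /= (setIidPr sD) [RHS]mulrAC -big_split /= [X in X * _]big1 ?mul1r.
  apply: eq_bigr => x /setDP[xl _]; have [h0 hE] := hook_lab xl.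
  have X0 := row_neq0 x.1; have hn := natRF_neq0 h0; have bn := beta_neq0.
  have -> : b * (nth 0%N lam x.1 + d - x.1)%:R + 1 = rowlab x.1 by rewrite addrC.
  by rewrite (inv_weight X0 hn bn hE).
by move=> x /(subsetP sD) xl; rewrite mulVf ?wgt_neq0.
Qed.

Definition ratio (f : nat -> nat) : RF :=
  \prod_(i < d) ((1 + b * (f i + d - i)%N%:R) / (1 + b * (nth 0%N lam i + d - i)%N%:R)).

Lemma ratioE f : ratio f = (\prod_(i < d) (1 + b * (f i + d - i)%:R)) / \prod_(i < d) rowlab i.
Proof. by rewrite /ratio big_split /= prodfV. Qed.

Lemma prod_row_neq0 : \prod_(i < d) rowlab i != 0.
Proof. by apply/prodf_neq0 => i _; exact: row_neq0. Qed.

Lemma ratio_neq1 mu : (forall i, nth 0 mu i <= nth 0 lam i)%N -> skewc d lam mu != set0 ->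
  ratio (nth 0%N mu) - 1 != 0.
Proof.
move=> ml s0; have [x] : exists x : cellT, x \in skewc d lam mu by exact/set0Pn.
rewrite mem_skewc => xs; rewrite subr_eq0; apply/eqP.
rewrite ratioE => /(congr1 ( *%R^~ (\prod_(i < d) rowlab i))).
rewrite mul1r divfK ?prod_row_neq0 // => /prod_step_inj e.
have := e _ x.1; rewrite /= => {}e.
suff : (nth 0 mu x.1 + d - x.1 = nth 0 lam x.1 + d - x.1)%N.
  by move: xs => /andP[xs1 xs2]; have := ltn_ord x.1; have := leq_ltn_trans xs1 xs2; lia.
by apply: e => i; have := ml i; lia.
Qed.

Lemma chevalley_rows L mu : lin L (nth 0%N lam) -> decr (nth 0%N mu) ->
  (forall i, nth 0 mu i <= nth 0 lam i)%N ->
  (ratio (nth 0%N mu) - 1) * loc L (edge d (nth 0%N mu)) =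
  \sum_(R : {set 'I_d} | layer lam mu R && (R != set0)) loc L (edge d (nth 0%N (grow mu R))).
Proof.
move=> lL dm ml.
have mc i : (nth 0 mu i <= c)%N by exact: leq_trans (lam_le dlam i).
have gd := good_lin lL (fun i _ => row_neq0 i) labelled_lam.
have := chevalley (edge d (nth 0%N mu)) gd.
rewrite (@raises_edge d lam _ _ _ dm mc) wt_edge //; last by move=> i id; have := mc i; lia.
(* The empty set gives back [mu] and accounts for the [- 1] on the left. *)
rewrite (bigD1 set0) /=; last by apply/forall_inP => i; rewrite inE.
have -> : (fun i => nth 0 mu i + nmem (set0 : {set 'I_d}) i)%N = nth 0%N mu.
  apply: functional_extensionality => i; have -> : nmem (set0 : {set 'I_d}) i = false;
    last exact: addn0.
  by apply/imageP => -[k]; rewrite inE.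
have -> : \prod_(i < d) steplab (nth 0%N mu i + d - i.+1)%N = \prod_(i < d) (1 + b * (nth 0 mu i + d - i)%:R).
  by apply: eq_bigr => i _; rewrite /steplab -subSn ?subSS // (leq_trans (ltn_ord i)) ?leq_addl.
move=> e; rewrite mulrBl mul1r ratioE mulrAC e mulrAC divff ?prod_row_neq0 // mul1r [LHS]addrC addKr.
rewrite (bigID (layer lam mu)) /= [X in _ + X]big1 ?addr0.
  apply: eq_big => [R|R /andP[_ lR]].
    case: (boolP (layer lam mu R)) => lR; rewrite ?andbF // andbT /=; apply: andb_idl => _.
    by apply/forall_inP => i iR; have /forall_inP/(_ i iR)/andP[] := lR.
  by congr (loc L (edge d _)); apply: functional_extensionality => i; rewrite (nth_grow slam ml).
(* Sets of corners that leave [lam] contribute zero by [loc_edge_out]. *)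
move=> R /andP[/andP[cR _] nlR].
have [i iR il] : exists2 i : 'I_d, i \in R & (nth 0 lam i <= nth 0 mu i)%N.
  have /forall_inPn[i iR nl] := nlR.
  exists i => //; move: nl; rewrite negb_and -leqNgt => /orP[//|/negP[]].
  by have /forall_inP/(_ i iR) := cR.
apply: (@loc_edge_out d lam _ rowlab collab L _ _ i lL (grow_decr dm cR)) => //.
  by move=> j; have := mc j; case: nmem; lia.
by rewrite nmemE iR addn1 ltnS.
Qed.

Lemma excited_sum L mu : lin L (nth 0%N lam) -> decr (nth 0%N mu) ->
  (forall i, nth 0 mu i <= nth 0 lam i)%N ->
  \sum_(D in excited d lam mu)
       (- beta) ^ ((#|D| : int) - (sumn lam : int)) *
       \prod_(x in diag d lam lam :\: D)
          ((beta * (nth 0%N lam x.1 + d - x.1)%N%:R + 1) / (hook lam x.1 x.2)%:R)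
  = diag_const * loc L (edge d (nth 0%N mu)).
Proof.
move=> lL dm ml; rewrite (loc_edge _ _ lL dm ml) mulr_sumr.
apply: eq_big => [D|D]; rewrite inE // => cD.
apply: term_excited.
have : diag d lam mu \subset shape d lam (nth 0%N lam).
  by apply/subsetP => x; rewrite !inE /in_diag => h; exact: leq_trans (ml _).
by move=> s; exact: connect_mv_sub s cD.
Qed.

(** A move needs a free cell of [lam], and there is none. *)
Lemma excited_lam : excited d lam lam = [set diag d lam lam].
Proof.
apply/setP => D; rewrite !inE; apply/idP/eqP => [|->]; last exact: connect0.
case/connectP=> -[|T p] /=; first by move=> _ ->.
move=> /andP[/mvP[u [v [_ _ _ /andP[f4 f5] [v1 v2 _]]]] _] _.
by move: f5; rewrite -v1 -v2 memcE inE /in_diag v1 v2 f4.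
Qed.

(** Induction on the number of cells of the skew shape: peeling off the entries 1 matches the
    Chevalley recursion. *)
Lemma SIT_sum L mu : lin L (nth 0%N lam) -> decr (nth 0%N mu) ->
  (forall i, nth 0 mu i <= nth 0 lam i)%N ->
  \sum_(T in SIT d lam mu) \prod_(1 <= k < (mT T).+1) (ratio (nu mu T k) - 1)^-1
  = diag_const * loc L (edge d (nth 0%N mu)).
Proof.
move=> lL; have [m] := ubnP #|skewc d lam mu|; elim: m mu => // m IH mu hm dm ml.
have [s0|s0] := eqVneq (skewc d lam mu) set0.
  (* Base case: the right-hand side is evaluated through its hook form at [lam], whose single
     diagram gives 1; the single tableau is the zero function. *)
  have e := skewc0P ml s0.
  rewrite (eq_edge e) -(excited_sum lL dlam (fun=> leqnn _)) excited_lam big_set1.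
  rewrite setDv big_set0 mulr1 (card_lam dlam slam) subrr expr0z.
  rewrite (big_pred1 [ffun=> ord0]) => [|T].
    rewrite big_geq // ltnS leqn0; apply/eqP/eqP; rewrite -leqn0.
    by apply: mT_leq => x; rewrite ffunE.
  rewrite inE /=; apply/SITP/eqP => [[h _ _ _]|->].
    by apply/ffunP => x; rewrite ffunE; apply: val_inj; have := h x; rewrite s0 inE /=; case: posnP.
  split; try by move=> x y; rewrite s0 inE.
    by move=> x; rewrite s0 inE ffunE.
  move=> k /andP[k0 km]; have : (mT ([ffun=> ord0] : tabT d lam) <= 0)%N.
    by apply: mT_leq => x; rewrite ffunE.
  by rewrite leqNgt (leq_trans k0 km).
rewrite (SIT_peel dlam slam ml) //; last first.
  by move=> f g fg; apply: eq_bigr => i _; rewrite fg.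
(* Multiplying by the nonzero [ratio (nth 0 mu) - 1] lets [chevalley_rows] rewrite the right-hand
   side as a sum over the same layers. *)
apply: (mulfI (ratio_neq1 ml s0)).
rewrite mulrA divff ?(ratio_neq1 ml s0) // mul1r mulrCA (chevalley_rows lL dm ml) mulr_sumr.
apply: eq_bigr => R /andP[lR R0].
have lR' := layerP _ _ _ lR.
have gE := nth_grow slam ml R.
apply: IH.
- apply: leq_trans (_ : #|skewc d lam mu| <= m)%N; last by rewrite -ltnS.
  have /set0Pn[i iR] := R0; have [il _] := lR' i iR.
  have ic : (nth 0 mu i < c)%N by exact: leq_trans il (lam_le dlam i).
  apply: proper_card; apply/properP; split.
    by apply/subsetP => x; rewrite (mem_skewc_grow slam ml) => /andP[].
  exists (i, Ordinal ic); first by rewrite mem_skewc /= leqnn.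
  by rewrite (mem_skewc_grow slam ml) /= iR eqxx andbF.
- have cR : [forall i in R, forall j : 'I_d, (j < i) ==> (nth 0 mu (val i) < nth 0 mu (val j))]%N.
    apply/forall_inP => i iR; apply/forallP => j; apply/implyP => ji.
    by have [_ [_]] := lR' i iR; exact.
  by have := grow_decr dm cR => h i j ij; rewrite !gE; exact: h.
move=> i; rewrite gE; case: (boolP (nmem R i)) => [iR|_]; last by rewrite addn0.
have id := nmem_lt iR; rewrite (nmem_ord _ id) in iR.
by rewrite addn1; have [] := lR' _ iR.
Qed.

End Final.

Unset Implicit Arguments.

Local Open Scope ring_scope.

Theorem theorem1p4 (d : nat) (lam mu : seq nat) :
  (0 < d)%N -> is_part lam -> is_part mu -> subpart mu lam -> (size lam <= d)%N ->
  \sum_(T in SIT d lam mu)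
     \prod_(1 <= k < (mT T).+1)
        ((\prod_(i < d)
            ((1 + beta * (nu mu T k i + d - i)%N%:R) /
             (1 + beta * (nth 0 lam i + d - i)%N%:R))) - 1)^-1
  = \sum_(D in excited d lam mu)
       (- beta) ^ ((#|D| : int) - (sumn lam : int)) *
       \prod_(x in diag d lam lam :\: D)
          ((beta * (nth 0 lam x.1 + d - x.1)%N%:R + 1) /
           (hook lam x.1 x.2)%:R).
Proof.
move=> _ plam pmu ml slam.
(* Both sides equal [diag_const] times [loc] at the edge word of [mu], computed along a linear
   extension [L] of [lam]. *)
have [L lL] := lin_exists (part_decr plam) (lam_out slam) (lam_le (part_decr plam)).
rewrite (excited_sum plam slam lL (part_decr pmu) ml).
exact: (SIT_sum plam slam lL (part_decr pmu) ml).
Qed.
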